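(* Suppose there is a family of list-decodable binary codes with parameters $(\alpha,R(\alpha),L)$, i.e. codes of length $n$ and rate $R(\alpha)$ such that the $\alpha n$-neighbourhood of every word of $\{0,1\}^n$ contains at most $L$ codewords, and suppose that: (1) the codes are linear; (2) $L=O(\mathrm{poly}(n))$; (3) there is an efficient list-decoding algorithm which, for every $y\in\{0,1\}^n$, finds the list of the (at most $L$) codewords $z_i$ with $\rho(y,z_i)\le\alpha n$. Then for every $a=a(n)$ with $a=\Omega(1)$ and $a=2^{o(n)}$ one can construct from these codes a one-round probabilistic protocol for the probabilistic file synchronization problem with communication complexity $$C=(1-R(\alpha))\,n+o(n)$$ and error probability at most $\frac1a$. The computational complexity of this protocol is $$T_{\mathrm{code}}+O\bigl(anL^2\log(anL^2)\bigr)+O(Ln^2)+O(n^3),$$ where $T_{\mathrm{code}}$ is the computational complexity of the code (of its list-decoding algorithm).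
   Context: $\rho$ denotes the Hamming distance, $\log$ the binary logarithm. Probabilistic file synchronization problem: Alice holds $X\in\{0,1\}^n$, Bob holds $Y\in\{0,1\}^n$, and it is known in advance that $\rho(X,Y)\le\alpha n$. Each of them has a private source of random bits. They exchange bits according to a protocol agreed on in advance; at the end Bob must output $X$, with error probability (over the random bits, for the worst-case admissible $(X,Y)$) at most a given $\varepsilon$. The communication complexity is the total number of bits sent in the worst case. One-round means that only a single message is sent, from Alice to Bob. A code of length $n$ has rate $R$ if it has $2^{Rn}$ codewords. *)

(* Defs.v *)
From HB Require Import structures.
From mathcomp Require Import all_boot all_order all_algebra.
From mathcomp Require Import all_classical all_reals all_analysis.

Set Implicit Arguments.
Unset Strict Implicit.
Unset Printing Implicit Defensive.

Import Order.TTheory GRing.Theory Num.Theory.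
Import numFieldNormedType.Exports.

Local Open Scope classical_set_scope.
Local Open Scope ring_scope.

Definition hamming n (x y : 'rV['F_2]_n) : nat :=
  #|[set i : 'I_n | x 0 i != y 0 i]%SET|.

Definition log2 (R : realType) (x : R) : R := ln x / ln 2.

(** Landau relations as [n] tends to infinity within a set [N] of lengths.  The
    filter is named because the token [=o_(] is reserved for another notation. *)

Definition little_o (R : realType) (N : set nat) (f g : nat -> R) : Prop :=
  let F := within N \oo in f =o_F g.

Definition big_O (R : realType) (N : set nat) (f g : nat -> R) : Prop :=
  let F := within N \oo in f =O_F g.

Definition big_Omega (R : realType) (N : set nat) (f g : nat -> R) : Prop :=
  let F := within N \oo in f =Omega_F g.

(** * Codes *)

Definition linear_code n (C : {set 'rV['F_2]_n}) : Prop :=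
  submod_closed (mem C).

Definition generator_matrix n k (G : 'M['F_2]_(k, n)) (C : {set 'rV['F_2]_n})
    : Prop :=
  row_free G /\ C = [set x | (x <= G)%MS]%SET.

Definition neighbours (R : realType) (alpha : R) n (C : {set 'rV['F_2]_n})
    (y : 'rV['F_2]_n) : {set 'rV['F_2]_n} :=
  [set z in C | (hamming y z)%:R <= alpha * n%:R]%SET.

Definition list_decodable (R : realType) (alpha : R) (L : nat) n
    (C : {set 'rV['F_2]_n}) : Prop :=
  forall y : 'rV['F_2]_n, (#|neighbours alpha C y| <= L)%N.

(** * One-round protocols with private coins *)

Record protocol (n : nat) := Protocol {
  coinsA : nat;
  coinsB : nat;
  send : 'rV['F_2]_n -> coinsA.-tuple bool -> seq bool;
  recv : 'rV['F_2]_n -> coinsB.-tuple bool -> seq bool -> 'rV['F_2]_n }.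

Definition admissible (R : realType) (alpha : R) n (x y : 'rV['F_2]_n) : bool :=
  (hamming x y)%:R <= alpha * n%:R.

Definition error_probability (R : realType) n (P : protocol n)
    (x y : 'rV['F_2]_n) : R :=
  #|[set r : (coinsA P).-tuple bool * (coinsB P).-tuple bool
      | recv y r.2 (send x r.1) != x]%SET|%:R
  / #|{: (coinsA P).-tuple bool * (coinsB P).-tuple bool}|%:R.

Definition communication (R : realType) (alpha : R) n (P : protocol n) : nat :=
  \max_(z : 'rV['F_2]_n * 'rV['F_2]_n | admissible alpha z.1 z.2)
    \max_(r : (coinsA P).-tuple bool) size (send z.1 r).

(** * Machine model

    A random access machine under the uniform cost criterion, programmed in a
    structured language.  The only arithmetic is addition and truncated
    subtraction.  As with the tapes of a multi-tape Turing machine, a program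
    uses a fixed finite number of registers and of unbounded arrays; a program
    is a closed term, so it does not depend on the length of its input. *)

Inductive expr :=
| Cst of nat
| Reg of nat
| Get of nat & expr
| Add of expr & expr
| Sub of expr & expr.

Inductive prog :=
| Skip
| Assign of nat & expr
| Store of nat & expr & expr
| Seq of prog & prog
| If of expr & prog & prog
| While of expr & prog.

Record state := State { reg : nat -> nat; arr : nat -> nat -> nat }.

Definition set_reg (x v : nat) (s : state) : state :=
  State (fun y => if y == x then v else reg s y) (arr s).

Definition set_arr (A : nat) (f : nat -> nat) (s : state) : state :=
  State (reg s) (fun B => if B == A then f else arr s B).

Definition set_cell (A i v : nat) (s : state) : state :=
  set_arr A (fun j => if j == i then v else arr s A j) s.

Fixpoint eval (s : state) (e : expr) : nat :=
  match e with
  | Cst c => c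
  | Reg x => reg s x
  | Get A e1 => arr s A (eval s e1)
  | Add e1 e2 => (eval s e1 + eval s e2)%N
  | Sub e1 e2 => (eval s e1 - eval s e2)%N
  end.

Fixpoint ecost (e : expr) : nat :=
  match e with
  | Cst _ | Reg _ => 1%N
  | Get _ e1 => (ecost e1).+1
  | Add e1 e2 | Sub e1 e2 => (ecost e1 + ecost e2).+1
  end.

(** [exec p s t s']: started in [s], the program [p] halts in [s'] after [t]
    elementary steps. Guards are true when nonzero. *)
Inductive exec : prog -> state -> nat -> state -> Prop :=
| ExecSkip s : exec Skip s 1 s
| ExecAssign x e s :
    exec (Assign x e) s (ecost e).+1 (set_reg x (eval s e) s)
| ExecStore A e1 e2 s :
    exec (Store A e1 e2) s (ecost e1 + ecost e2).+1
      (set_cell A (eval s e1) (eval s e2) s)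
| ExecSeq p q s t1 s1 t2 s2 :
    exec p s t1 s1 -> exec q s1 t2 s2 -> exec (Seq p q) s (t1 + t2)%N s2
| ExecIfTrue e p q s t s' :
    eval s e != 0%N -> exec p s t s' ->
    exec (If e p q) s ((ecost e).+1 + t)%N s'
| ExecIfFalse e p q s t s' :
    eval s e = 0%N -> exec q s t s' ->
    exec (If e p q) s ((ecost e).+1 + t)%N s'
| ExecWhileStop e p s :
    eval s e = 0%N -> exec (While e p) s (ecost e).+1 s
| ExecWhileLoop e p s t1 s1 t2 s2 :
    eval s e != 0%N -> exec p s t1 s1 -> exec (While e p) s1 t2 s2 ->
    exec (While e p) s ((ecost e).+1 + t1 + t2)%N s2.

(** * Input and output conventions *)

Definition reg_length := 0%N.
Definition reg_dim := 1%N.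
Definition reg_radius := 2%N.
Definition reg_list := 3%N.
Definition reg_accuracy := 4%N.
Definition reg_count := 5%N.

Definition arr_code := 0%N.
Definition arr_word := 1%N.
Definition arr_coins := 2%N.
Definition arr_msg := 3%N.
Definition arr_out := 4%N.

(** Row-major layout, padded with zeros. *)
Definition cells k n (M : 'M['F_2]_(k, n)) (p : nat) : nat :=
  match insub (p %/ n)%N, insub (p %% n)%N with
  | Some i, Some j => M i j
  | _, _ => 0%N
  end.

Definition bit_cells (s : seq bool) (i : nat) : nat := nth false s i.

Definition zero_state : state := State (fun _ => 0%N) (fun _ _ => 0%N).

(** What is agreed on in advance about the code of length [n]: a generator
    matrix and the numeric parameters. *)
Definition code_state n k (radius L : nat) (G : 'M['F_2]_(k, n)) : state :=
  set_arr arr_code (cells G)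
    (set_reg reg_list L
      (set_reg reg_radius radius
        (set_reg reg_dim k (set_reg reg_length n zero_state)))).

Definition decoder_input n (s0 : state) (y : 'rV['F_2]_n) : state :=
  set_arr arr_word (cells y) s0.

Definition alice_input n (s0 : state) (acc : nat) (x : 'rV['F_2]_n)
    (r : seq bool) : state :=
  set_reg reg_accuracy acc
    (set_arr arr_coins (bit_cells r) (set_arr arr_word (cells x) s0)).

Definition bob_input n (s0 : state) (acc : nat) (y : 'rV['F_2]_n)
    (r m : seq bool) : state :=
  set_reg reg_count (size m)
    (set_arr arr_msg (bit_cells m) (alice_input s0 acc y r)).

Definition outputs_list n (s : state) (l : seq 'rV['F_2]_n) : Prop :=
  reg s reg_count = size l /\
  forall (i : nat) (j : 'I_n), (i < size l)%N ->
    arr s arr_out (i * n + j)%N = nth 0 l i 0 j :> nat.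

Definition outputs_message (s : state) (m : seq bool) : Prop :=
  reg s reg_count = size m /\
  forall i : nat, (i < size m)%N -> arr s arr_msg i = nth false m i :> nat.

Definition outputs_word n (s : state) (x : 'rV['F_2]_n) : Prop :=
  forall j : 'I_n, arr s arr_out j = x 0 j :> nat.

(** On the agreed data [s0], the program [D] finds, within [T] steps and for
    every [y], all codewords at distance at most [alpha * n] from [y], each
    listed once. *)
Definition list_decodes_within (R : realType) (alpha : R) n
    (C : {set 'rV['F_2]_n}) (s0 : state) (D : prog) (T : nat) : Prop :=
  forall y : 'rV['F_2]_n, exists t s l,
    [/\ exec D (decoder_input s0 y) t s,
        outputs_list s l,
        uniq l,
        l =i neighbours alpha C y
      & (t <= T)%N].

(** On the agreed data [s0] and [acc], an integer encoding the prescribed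
    accuracy, the programs [A] and [B] carry out [P] on all admissible inputs,
    and together they make at most [T] steps. *)
Definition implemented_within (R : realType) (alpha : R) n (P : protocol n)
    (s0 : state) (acc : nat) (A B : prog) (T : R) : Prop :=
  forall (x y : 'rV['F_2]_n) (rA : (coinsA P).-tuple bool)
         (rB : (coinsB P).-tuple bool),
    admissible alpha x y ->
    exists tA sA tB sB,
      [/\ exec A (alice_input s0 acc x rA) tA sA,
          outputs_message sA (send x rA),
          exec B (bob_input s0 acc y rB (send x rA)) tB sB,
          outputs_word sB (recv y rB (send x rA))
        & (tA + tB)%:R <= T].

(* Main.v *)
Require Import Defs.
From HB Require Import structures.
From mathcomp Require Import all_boot all_order all_algebra.
From mathcomp Require Import all_classical all_reals all_analysis.
From mathcomp Require Import zify ring lra.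

(** Alice and Bob run the same Gaussian elimination on the generator matrix.
    Alice reduces [x] modulo the code to a representative [e] of its coset which
    vanishes at the [k] pivots, and sends the other [n - k] bits of [e].  Since
    [x + e] is a codeword at distance at most [alpha * n] from [y + e], Bob finds
    [x] among the at most [L] words [z + e], with [z] in the list of [y + e].

    To single out [x], Alice also sends a random seed and a hash of [x].  Cut [x]
    into [q] blocks of length [b = q * m] and apply to each block the same random
    Hankel matrix, [m] by [b] over the field with two elements: a nonzero block is
    mapped to 0 with probability [2 ^ - m].  So [m ~ log a + log L] makes the error
    at most [1 / a], and [q ~ sqrt (n / m)] makes the [q * m] bits of the hash and
    the [q * m + m] bits of the seed [o(n)] as soon as [m = o(n)].  Every hash costs
    [(q * m) ^ 2 = O(n ^ 2)] steps, hence no term in [a] is needed in the time. *)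

Set Implicit Arguments.
Unset Strict Implicit.
Unset Printing Implicit Defensive.

Import Order.TTheory GRing.Theory Num.Theory.
Import numFieldNormedType.Exports.

Local Open Scope classical_set_scope.
Local Open Scope ring_scope.

Local Notation eval := Defs.eval.
Local Notation Sub := Defs.Sub.

(** * Timed execution *)

(** The coins are private, so the seed itself must travel. One Hankel matrix applied to the whole of
    [x] would cost at least [n] extra bits of seed; cutting into [q] blocks trades seed length
    against hash length. Sharing the matrix among blocks loses nothing, since a wrong candidate must
    already survive in a single block where it differs from [x]. The machine is the second obstacle.
    Programs are fixed terms without multiplication or division, so both parties recompute [m], [q]
    and [q * m] by additions from the list size and the accuracy, and all addresses advance by
    additions. Moreover the decoder is an arbitrary program whose behaviour is known only from one
    exact initial state. Hence the separation between the pure functions [message] and [receive],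
    which carry the probability argument, and the programs, shown to compute them within explicit
    step counts. *)

Definition runs (p : prog) (s : state) (T : nat) (Q : state -> Prop) : Prop :=
  exists t s', [/\ exec p s t s', Q s' & (t <= T)%N].

Lemma runs_le p s T T' (Q Q' : state -> Prop) :
  runs p s T Q -> (T <= T')%N -> (forall s', Q s' -> Q' s') -> runs p s T' Q'.
Proof.
move=> [t [s' [e q l]]] lT QQ; exists t, s'.
by split=> //; [exact: QQ | exact: leq_trans lT].
Qed.

Lemma runs_leT p s T T' (Q : state -> Prop) :
  runs p s T Q -> (T <= T')%N -> runs p s T' Q.
Proof. by move=> rp lT; apply: runs_le rp lT _. Qed.

Lemma runs_post p s T (Q Q' : state -> Prop) :
  runs p s T Q -> (forall s', Q s' -> Q' s') -> runs p s T Q'.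
Proof. by move=> rp QQ; apply: runs_le rp (leqnn T) QQ. Qed.

Lemma runs_skip s (Q : state -> Prop) : Q s -> runs Skip s 1 Q.
Proof. by move=> q; exists 1%N, s; split=> //; constructor. Qed.

Lemma runs_assign x e s (Q : state -> Prop) :
  Q (set_reg x (eval s e) s) -> runs (Assign x e) s (ecost e).+1 Q.
Proof. by move=> q; exists (ecost e).+1, (set_reg x (eval s e) s); split=> //; constructor. Qed.

Lemma runs_store A e1 e2 s (Q : state -> Prop) :
  Q (set_cell A (eval s e1) (eval s e2) s) ->
  runs (Store A e1 e2) s (ecost e1 + ecost e2).+1 Q.
Proof. by move=> q; eexists; eexists; split; [constructor|exact: q|]. Qed.

(** The postcondition of [p] is itself a [runs] judgement for [q], so a program is stepped through
    by successive [apply]. *)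
Lemma runs_seq p q s T1 T2 (Q : state -> Prop) :
  runs p s T1 (fun s1 => runs q s1 T2 Q) -> runs (Seq p q) s (T1 + T2)%N Q.
Proof.
move=> [t1 [s1 [e1 [t2 [s2 [e2 q2 l2]]] l1]]]; exists (t1 + t2)%N, s2.
by split=> //; [apply: ExecSeq e1 e2 | exact: leq_add].
Qed.

(** Charging both branches instead of their maximum keeps every bound polynomial and within reach of
    [lia]. *)
Lemma runs_if e p q s T1 T2 (Q : state -> Prop) :
  (eval s e != 0%N -> runs p s T1 Q) -> (eval s e = 0%N -> runs q s T2 Q) ->
  runs (If e p q) s ((ecost e).+1 + (T1 + T2))%N Q.
Proof.
case: (eqVneq (eval s e) 0%N) => [e0 _ | e1 + _].
- move=> /(_ e0) [t [s' [ee q' l]]]; exists ((ecost e).+1 + t)%N, s'.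
  by split=> //; [exact: ExecIfFalse | lia].
- move=> /(_ isT) [t [s' [ee q' l]]]; exists ((ecost e).+1 + t)%N, s'.
  by split=> //; [exact: ExecIfTrue | lia].
Qed.

(** The caller supplies the exact number of turns; the proof is an induction on the number [j] of
    turns that remain. *)
Lemma runs_while e p s T N (Inv : nat -> state -> Prop) :
  Inv 0%N s ->
  (forall i s1, (i < N)%N -> Inv i s1 ->
     eval s1 e != 0%N /\ runs p s1 T (Inv i.+1)) ->
  (forall s1, Inv N s1 -> eval s1 e = 0%N) ->
  runs (While e p) s (N * ((ecost e).+1 + T) + (ecost e).+1)%N (Inv N).
Proof.
move=> I0 step stop.
suff H j i s1 : (i + j = N)%N -> Inv i s1 ->
    runs (While e p) s1 (j * ((ecost e).+1 + T) + (ecost e).+1)%N (Inv N).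
  exact: H I0.
elim: j i s1 => [|j IH] i s1.
  rewrite addn0 => -> IN; exists (ecost e).+1, s1.
  by split=> //; constructor; exact: stop.
move=> ij Ii; have iN : (i < N)%N by lia.
have [g [t1 [s2 [e1 I1 l1]]]] := step _ _ iN Ii.
have [|t2 [s3 [e2 I2 l2]]] := IH i.+1 s2 _ I1; first by lia.
exists ((ecost e).+1 + t1 + t2)%N, s3; split=> //; last by lia.
exact: ExecWhileLoop e1 e2.
Qed.

(** Truncated subtraction serves as comparison: the guard is nonzero exactly while the counter is
    below the bound, which is evaluated again at every turn. *)
Definition For (i : nat) (bound : expr) (body : prog) : prog :=
  Seq (Assign i (Cst 0))
    (While (Sub bound (Reg i)) (Seq body (Assign i (Add (Reg i) (Cst 1))))).

Fixpoint wregs (p : prog) : seq nat :=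
  match p with
  | Skip | Store _ _ _ => [::]
  | Assign x _ => [:: x]
  | Seq p q | If _ p q => wregs p ++ wregs q
  | While _ p => wregs p
  end.

Fixpoint warrs (p : prog) : seq nat :=
  match p with
  | Skip | Assign _ _ => [::]
  | Store A _ _ => [:: A]
  | Seq p q | If _ p q => warrs p ++ warrs q
  | While _ p => warrs p
  end.

(** A frame condition read off the syntax. For a concrete program the nonmembership side conditions
    reduce to [true], whence the many [isT] below. *)
Definition keeps (p : prog) (s s' : state) : Prop :=
  (forall x, x \notin wregs p -> reg s' x = reg s x) /\
  (forall A, A \notin warrs p -> arr s' A = arr s A).

Lemma exec_keeps p s t s' : exec p s t s' -> keeps p s s'.
Proof.
elim=> {p s t s'} /=.
- by [].
- by move=> x e s; split=> //= y; rewrite inE => /negbTE ->.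
- by move=> A e1 e2 s; split=> //= B; rewrite inE => /negbTE ->.
- move=> p q s t1 s1 t2 s2 _ [r1 a1] _ [r2 a2]; split=> x /=;
    rewrite mem_cat negb_or => /andP[px qx].
  + by rewrite r2 // r1.
  + by rewrite a2 // a1.
- move=> e p q s t s' _ _ [r1 a1]; split=> x /=;
    rewrite mem_cat negb_or => /andP[px qx]; [exact: r1 | exact: a1].
- move=> e p q s t s' _ _ [r1 a1]; split=> x /=;
    rewrite mem_cat negb_or => /andP[px qx]; [exact: r1 | exact: a1].
- by [].
- move=> e p s t1 s1 t2 s2 _ _ [r1 a1] _ [r2 a2]; split=> x /= nx.
  + by rewrite r2 // r1.
  + by rewrite a2 // a1.
Qed.

Lemma runs_keeps p s T (Q : state -> Prop) :
  runs p s T Q -> runs p s T (fun s' => Q s' /\ keeps p s s').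
Proof.
by move=> [t [s' [e q l]]]; exists t, s'; split=> //; split=> //; exact: exec_keeps e.
Qed.

Lemma runs_call p s T T' (Q Q' : state -> Prop) :
  runs p s T Q -> (T <= T')%N ->
  (forall s', Q s' -> keeps p s s' -> Q' s') -> runs p s T' Q'.
Proof.
by move=> /runs_keeps rp lT H; apply: runs_le rp lT _ => s' [q kp]; exact: H.
Qed.

Lemma runs_seq_call p q s T1 T2 (Q1 Q : state -> Prop) :
  runs p s T1 Q1 ->
  (forall s1, Q1 s1 -> keeps p s s1 -> runs q s1 T2 Q) ->
  runs (Seq p q) s (T1 + T2)%N Q.
Proof. by move=> rp H; apply: runs_seq; apply: runs_call rp (leqnn _) H. Qed.

(* The invariant speaks about the registers and arrays written by the body;
   everything else is carried through by [keeps]. *)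
Lemma runs_for i bound body s T N (Inv : nat -> state -> Prop) :
  i \notin wregs body ->
  (forall s1, keeps (For i bound body) s s1 -> eval s1 bound = N) ->
  Inv 0%N (set_reg i 0%N s) ->
  (forall j s1, (j < N)%N -> keeps (For i bound body) s s1 -> reg s1 i = j ->
     Inv j s1 ->
     runs body s1 T (fun s2 => Inv j.+1 (set_reg i j.+1 s2))) ->
  runs (For i bound body) s (N * (ecost bound + T + 7) + (ecost bound + 5))%N
    (fun s1 => Inv N s1 /\ reg s1 i = N).
Proof.
move=> ni hb I0 step; set k := keeps _ _ in hb step.
have kp s1 s2 : k s1 -> keeps (Seq body (Assign i (Add (Reg i) (Cst 1)))) s1 s2 -> k s2.
  move=> [r1 a1] [r2 a2]; split=> x nx.
    by rewrite r2 ?r1 //; move: nx; rewrite inE negb_or => /andP[].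
  by rewrite a2 ?a1 //; move: nx; rewrite inE.
apply: (@runs_leT _ _ (2 + (N * ((ecost bound).+2.+1 + (T + 4)) + (ecost bound).+2.+1))%N);
  last by lia.
apply: runs_seq; apply: runs_assign => /=.
pose J j s1 := [/\ Inv j s1, reg s1 i = j & k s1].
have := @runs_while (Sub bound (Reg i)) (Seq body (Assign i (Add (Reg i) (Cst 1))))
  (set_reg i 0%N s) (T + 4)%N N J.
rewrite /= !addn1 => H; apply: (runs_le (H _ _ _) (leqnn _)) => [||s1|s1].
- split=> //=; first by rewrite eqxx.
  split=> x //=; rewrite inE negb_or => /andP[/negbTE -> //].
- move=> j s1 jN [Ij ij k1]; rewrite hb // ij; split; first by lia.
  apply: (@runs_le _ _ (T + 4) _ (fun s2 => [/\ Inv j.+1 s2, reg s2 i = j.+1 &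
    keeps (Seq body (Assign i (Add (Reg i) (Cst 1)))) s1 s2])) => //; last first.
    by move=> s2 [a b c]; split=> //; exact: kp c.
  apply: (@runs_le _ _ (T + 4) _ (fun s2 => (Inv j.+1 s2 /\ reg s2 i = j.+1) /\
    keeps (Seq body (Assign i (Add (Reg i) (Cst 1)))) s1 s2)) => //; last first.
    by move=> s2 [[a b] c].
  apply: runs_keeps; apply: runs_seq.
  apply: (runs_call (step _ _ jN k1 ij Ij) (leqnn _)) => s2 I2 [r2 _].
  apply: (@runs_leT _ _ 4); last by [].
  apply: runs_assign => /=; rewrite r2 // ij eqxx addn1; split=> //.
- by move=> [_ ij k1]; rewrite hb // ij subnn.
- by move=> [].
Qed.

(** * Bit streams and vectors *)

(** Infinite streams match the unbounded arrays of the machine and avoid ordinals; [supported n]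
    marks those that come from vectors of length [n]. *)
Definition bits := nat -> bool.

Definition addbits (u v : bits) : bits := fun i => u i (+) v i.

Definition bits_of n (x : 'rV['F_2]_n) : bits :=
  fun i => if insub i is Some j then x 0 j != 0 else false.

Definition vec n (u : bits) : 'rV['F_2]_n := \row_j (u j)%:R.

Definition supported n (u : bits) : Prop := forall l, (n <= l)%N -> u l = false.

Lemma F2_bool (z : 'F_2) : z = (z != 0)%:R.
Proof. by case: z => [[|[|//]]] ?; apply: val_inj. Qed.

Lemma F2_nat (z : 'F_2) : z = (z != 0) :> nat.
Proof. by case: z => [[|[|//]]]. Qed.

Lemma natr_addb (a b : bool) : (a (+) b)%:R = a%:R + b%:R :> 'F_2.
Proof. by case: a b => [] []; apply: val_inj. Qed.

Lemma natr_neq0 (a : bool) : (a%:R != 0 :> 'F_2) = a.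
Proof. by case: a. Qed.

Lemma rV2_addxx n (x : 'rV['F_2]_n) : x + x = 0.
Proof.
by apply/rowP => j; rewrite !mxE (F2_bool (x 0 j)) -natr_addb addbb.
Qed.

Lemma bits_ofE n (x : 'rV['F_2]_n) (j : 'I_n) : bits_of x j = (x 0 j != 0).
Proof. by rewrite /bits_of valK. Qed.

Lemma bits_of_supported n (x : 'rV['F_2]_n) : supported n (bits_of x).
Proof. by move=> l nl; rewrite /bits_of insubF // ltnNge nl. Qed.

Lemma bits_ofK n : cancel (@bits_of n) (vec n).
Proof. by move=> x; apply/rowP => j; rewrite mxE bits_ofE -F2_bool. Qed.

Lemma vecK n u : supported n u -> bits_of (vec n u) = u.
Proof.
move=> su; apply/funext => i; case: (ltnP i n) => [lt_in|le_ni].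
  by rewrite (bits_ofE _ (Ordinal lt_in)) mxE natr_neq0.
by rewrite (bits_of_supported _ le_ni) su.
Qed.

Lemma vecD n u v : vec n (addbits u v) = vec n u + vec n v.
Proof. by apply/rowP => j; rewrite !mxE natr_addb. Qed.

Lemma bits_ofD n (x y : 'rV['F_2]_n) :
  bits_of (x + y) = addbits (bits_of x) (bits_of y).
Proof.
rewrite -{1}(bits_ofK x) -{1}(bits_ofK y) -vecD vecK // => l nl.
by rewrite /addbits !bits_of_supported.
Qed.

Lemma cells_row n (x : 'rV['F_2]_n) : cells x = (fun i => bits_of x i : nat).
Proof.
apply/funext => i; rewrite /cells.
case: (ltnP i n) => [lt_in|le_ni].
  rewrite divn_small // modn_small //.
  have -> : insub 0%N = Some (ord0 : 'I_1) by case: insubP => // a _ a0; congr Some; apply: val_inj.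
  rewrite (insubT (fun i => (i < n)%N) lt_in).
  by rewrite -[i in RHS]/(nat_of_ord (Ordinal lt_in)) bits_ofE -F2_nat.
rewrite (bits_of_supported _ le_ni).
(* For [n = 0] the quotient is 0 and the row index is valid; it is the column index that has no room
   in ['I_0]. *)
case: (posnP n) => [n0|n0].
  case: insubP => [a _ _|//]; case: insubP => [b|//]; exfalso.
  by have := ltn_ord b; rewrite [in X in (_ < X)%N -> _]n0.
have -> : insub (i %/ n)%N = None :> option 'I_1; last by [].
  by apply: insubF; apply: negbTE; rewrite -leqNgt divn_gt0.
Qed.

Definition matrix_rows k n (G : 'M['F_2]_(k, n)) (i : nat) : bits :=
  if insub i is Some j then bits_of (row j G) else (fun=> false).

Lemma matrix_rowsE k n (G : 'M['F_2]_(k, n)) (i : 'I_k) :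
  matrix_rows G i = bits_of (row i G).
Proof. by rewrite /matrix_rows valK. Qed.

Lemma cells_matrix k n (G : 'M['F_2]_(k, n)) i l : (l < n)%N ->
  cells G (i * n + l)%N = matrix_rows G i l.
Proof.
move=> ln; have n0 : (0 < n)%N by lia.
rewrite /cells /matrix_rows divnMDl // modnMDl divn_small // modn_small // addn0.
case: insubP => // j _ _.
rewrite (insubT (fun i => (i < n)%N) ln).
by rewrite -[l in RHS]/(nat_of_ord (Ordinal ln)) bits_ofE mxE -F2_nat.
Qed.

Lemma cells_outside k n (G : 'M['F_2]_(k, n)) p : (k * n <= p)%N -> cells G p = 0%N.
Proof.
move=> kn; rewrite /cells; case: (posnP n) => [n0|n0].
  by case: insubP => // a _ _; case: insubP => // b _ _; have := ltn_ord b; lia.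
have -> : insub (p %/ n)%N = None :> option 'I_k; last by [].
by apply: insubF; apply: negbTE; rewrite -leqNgt leq_divRL.
Qed.

(** * Elimination *)

(** The last one below [n], with default 0. An upward scan that overwrites its answer ends on it
    ([find_pivot]), and [conv_lead] uses the same notion inside a block of the hash. *)
Fixpoint lead (u : bits) (n : nat) : nat :=
  if n is n'.+1 then if u n' then n' else lead u n' else 0%N.

Definition clear n (v u : bits) : bits :=
  if v (lead u n) then addbits v u else v.

Fixpoint reduced_rows n (rows : nat -> bits) (i : nat) : seq bits :=
  if i is i'.+1 then
    rcons (reduced_rows n rows i') (foldl (clear n) (rows i') (reduced_rows n rows i'))
  else [::].

Definition reduced n (rows : nat -> bits) (i : nat) : bits :=
  foldl (clear n) (rows i) (reduced_rows n rows i).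

Definition pivots n (rows : nat -> bits) (k : nat) : seq nat :=
  [seq lead u n | u <- reduced_rows n rows k].

Lemma lead_lt (u : bits) n : (exists2 l, (l < n)%N & u l) -> (lead u n < n)%N /\ u (lead u n).
Proof.
elim: n => [|n IH] [l] //= ln ul; case: ifP => un; first by [].
have [|a b] := IH; last by split=> //; lia.
exists l => //; rewrite ltnS leq_eqVlt in ln; case/orP: ln => // /eqP ln.
by rewrite -ln ul in un.
Qed.

Lemma size_reduced_rows n rows i : size (reduced_rows n rows i) = i.
Proof. by elim: i => //= i IH; rewrite size_rcons IH. Qed.

Lemma reduced_rowsE n rows i : reduced_rows n rows i = [seq reduced n rows j | j <- iota 0 i].
Proof. by elim: i => // i IH; rewrite -addn1 iotaD map_cat -IH cats1 addn1. Qed.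

Lemma eq_reduced_rows n rows rows' i :
  (forall j, (j < i)%N -> rows j = rows' j) -> reduced_rows n rows i = reduced_rows n rows' i.
Proof.
elim: i => //= i IH H; rewrite IH ?H // => j ji; apply: H; lia.
Qed.

Lemma clear_supported n v u : supported n v -> supported n u -> supported n (clear n v u).
Proof.
by move=> sv su l nl; rewrite /clear; case: ifP => _; rewrite /addbits sv ?su.
Qed.

Lemma reduced_supported n rows i :
  (forall j, (j <= i)%N -> supported n (rows j)) -> supported n (reduced n rows i).
Proof.
rewrite /reduced; elim/ltn_ind: i => i IH H; rewrite reduced_rowsE.
suff A s v : (forall j, j \in s -> (j < i)%N) -> supported n v ->
    supported n (foldl (clear n) v [seq reduced n rows j | j <- s]).
  by apply: A; [move=> j; rewrite mem_iota | exact: H].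
elim: s v => //= j s IHs v Hs sv; apply: IHs.
  by move=> j' j's; apply: Hs; rewrite inE j's orbT.
apply: clear_supported => //; apply: IH; first by apply: Hs; rewrite inE eqxx.
by move=> j' j'j; apply: H; have := Hs j; rewrite inE eqxx => /(_ isT); lia.
Qed.

(** Only later rows must vanish at earlier leads: elimination is triangular and never substitutes
    backwards. *)
Definition echelon n (B : seq bits) : bool :=
  all (fun u => (lead u n < n)%N && u (lead u n)) B
  && pairwise (fun u v : bits => ~~ v (lead u n)) B.

(** Rows are used in order: once the entry at the lead of [u] is cancelled, all later rows vanish
    there, so adding them does not disturb it. *)
Lemma clear_lead n B v u : echelon n B -> List.In u B ->
  foldl (clear n) v B (lead u n) = false.
Proof.
elim/last_ind: B => // B w IH; rewrite /echelon all_rcons pairwise_rcons.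
move=> /andP[/andP[/andP[lw ww] aB] /andP[wB pB]].
rewrite foldl_rcons -cats1 => /(@List.in_app_or _ _ _ _) [uB|[<-|//]].
- have Hu : foldl (clear n) v B (lead u n) = false by apply: IH => //; apply/andP.
  have Hw : w (lead u n) = false.
    apply: negbTE; elim: {IH aB pB Hu} B wB uB => //= b B IHB /andP[wb wB] [<-//|]; exact: IHB.
  by rewrite {1}/clear; case: ifP; rewrite /addbits ?Hu ?Hw.
- by rewrite {1}/clear; case: ifP => // h; rewrite /addbits h ww.
Qed.

Lemma In_mem (T : eqType) (x : T) s : List.In x s -> x \in s.
Proof. by elim: s => //= a s IH [->|/IH]; rewrite inE ?eqxx // => ->; rewrite orbT. Qed.

(** * Row operations as linear combinations of the rows of the generator matrix *)

Section RowSpace.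
Variables (k n : nat) (G : 'M['F_2]_(k, n)).

Lemma foldl_clear_comb i B v :
  (forall u, List.In u B ->
     exists2 c : 'rV_k, vec n u = c *m G & forall j : 'I_k, (i <= j)%N -> c 0 j = 0) ->
  exists2 c : 'rV_k, vec n (foldl (clear n) v B) = vec n v + c *m G
    & forall j : 'I_k, (i <= j)%N -> c 0 j = 0.
Proof.
elim: B v => [|u B IH] v H /=.
  by exists 0 => [|j _]; rewrite ?mul0mx ?addr0 // mxE.
have [|c1 e1 z1] := IH (clear n v u); first by move=> w wB; apply: H; right.
have [c2 e2 z2] := H u (or_introl erefl).
rewrite {}e1 /clear; case: ifP => _; last by exists c1.
exists (c2 + c1) => [|j ij]; last by rewrite mxE z1 ?z2 ?addr0.
by rewrite vecD e2 mulmxDl addrA.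
Qed.

(** The passage from the rows of [G] to the reduced rows is unitriangular. The coefficient 1 at [i]
    is what later shows that a reduced row is nonzero. *)
Lemma reduced_comb (i : 'I_k) :
  exists c : 'rV_k, [/\ vec n (reduced n (matrix_rows G) i) = c *m G, c 0 i = 1
    & forall j : 'I_k, (i < j)%N -> c 0 j = 0].
Proof.
case: i => i; elim/ltn_ind: i => i IH ik.
have [|c ec zc] := @foldl_clear_comb i (reduced_rows n (matrix_rows G) i) (matrix_rows G i).
  move=> u; rewrite reduced_rowsE => /(@List.in_map_iff _ _ _ _ _) [j [<- ji]].
  have {}ji : (j < i)%N by move: (In_mem ji); rewrite mem_iota.
  have [c [ec _ zc]] := IH j ji (ltn_trans ji ik).
  by exists c => // j' j'i; apply: zc => /=; exact: leq_trans ji j'i.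
exists (delta_mx 0 (Ordinal ik) + c); split.
- rewrite /reduced /= ec (matrix_rowsE G (Ordinal ik)) bits_ofK rowE mulmxDl //.
- by rewrite !mxE !eqxx zc // addr0.
- move=> j ij; rewrite !mxE eqxx zc ?addr0 /=; last exact: ltnW.
  by case: eqP ij => // ->; rewrite ltnn.
Qed.

Lemma syndrome_comb v : exists c : 'rV_k,
  vec n (foldl (clear n) v (reduced_rows n (matrix_rows G) k)) = vec n v + c *m G.
Proof.
have [|c ec _] := @foldl_clear_comb k (reduced_rows n (matrix_rows G) k) v; last by exists c.
move=> u; rewrite reduced_rowsE => /(@List.in_map_iff _ _ _ _ _) [j [<- ji]].
have {}ji : (j < k)%N by move: (In_mem ji); rewrite mem_iota.
have [c [ec _ zc]] := reduced_comb (Ordinal ji).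
by exists c => // j'; rewrite leqNgt ltn_ord.
Qed.

Hypothesis Gfree : row_free G.

(** The coefficient vector is nonzero and the rows of [G] are independent, so the reduced row is
    nonzero and its lead is a genuine one, not the default. *)
Lemma reduced_lead i : (i < k)%N ->
  (lead (reduced n (matrix_rows G) i) n < n)%N
  && reduced n (matrix_rows G) i (lead (reduced n (matrix_rows G) i) n).
Proof.
move=> ik; set u := reduced _ _ _; apply/andP; apply: lead_lt.
have [c [ec c1 _]] := reduced_comb (Ordinal ik).
have /rV0Pn[j] : vec n u != 0.
  apply: contra_eqN c1 => /eqP; rewrite ec -[0 in RHS](mul0mx _ G) => /(row_free_inj Gfree) ->.
  by rewrite mxE eq_sym oner_eq0.
by rewrite mxE natr_neq0 => uj; exists j.
Qed.

Lemma reduced_rows_echelon i : (i <= k)%N -> echelon n (reduced_rows n (matrix_rows G) i).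
Proof.
elim: i => // i IH ik; have e := IH (ltnW ik).
have /andP[aB pB] := e.
rewrite /echelon /= all_rcons pairwise_rcons aB pB !andbT reduced_lead //=.
have := @clear_lead n _ (matrix_rows G i) _ e.
elim: {aB pB e} (reduced_rows n (matrix_rows G) i) (foldl _ _ _) => //= b B IHB w H.
rewrite IHB; last by move=> u uB; apply: H; right.
by rewrite (H b) //; left.
Qed.

End RowSpace.

(** * Syndromes *)

Definition is_free n (B : seq bits) (l : nat) : bool :=
  l \notin [seq lead u n | u <- B].

Definition pack n (B : seq bits) (e : bits) : seq bool :=
  [seq e l | l <- iota 0 n & is_free n B l].

(** Bit [l] of the syndrome was packed at the rank of [l] among the free positions. Reading by index
    ignores whatever follows in [m], here the seed and the hash. *)
Definition unpack n (B : seq bits) (m : seq bool) : bits :=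
  fun l => [&& (l < n)%N, is_free n B l
             & nth false m (count (is_free n B) (iota 0 l))].

(** The leads are pairwise distinct, because a later row vanishes at an earlier lead but not at its
    own; so exactly [size B] positions are not free. *)
Lemma size_pack n B e : echelon n B -> size (pack n B e) = (n - size B)%N.
Proof.
move=> /andP[aB pB]; rewrite size_map size_filter.
have sub : {subset [seq lead u n | u <- B] <= iota 0 n}.
  move=> l /mapP[u uB ->]; rewrite mem_iota /= add0n.
  by have /andP[] := allP aB _ uB.
have uB : uniq [seq lead u n | u <- B].
  rewrite uniq_pairwise pairwise_map.
  apply: (sub_in_pairwise (P := fun u => (lead u n < n)%N && u (lead u n))) pB => //.
  move=> u v /andP[_ ul] /andP[_ vl] /= nv; apply/eqP => e1.
  by rewrite e1 vl in nv.
have := count_predC (is_free n B) (iota 0 n); rewrite size_iota.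
suff -> : count (predC (is_free n B)) (iota 0 n) = size B.
  by move=> e1; apply: (canRL (addnK _)); exact: e1.
rewrite -size_filter -(size_map (fun u => lead u n)); apply: perm_size.
apply: uniq_perm => //; first exact: filter_uniq (iota_uniq _ _).
move=> l; rewrite mem_filter /= /is_free negbK.
by apply: andb_idr; exact: sub.
Qed.

Lemma unpack_pack n B e m : supported n e ->
  (forall u, List.In u B -> e (lead u n) = false) -> unpack n B (pack n B e ++ m) = e.
Proof.
move=> se eB; apply/funext => l; rewrite /unpack.
case: (ltnP l n) => [ln|/se -> //].
case: (boolP (is_free n B l)) => [fl|]; last first.
  rewrite negbK; elim: B eB => //= u B IH eB; rewrite inE => /orP[/eqP ->|].
    by rewrite eB //; left.
  by move=> lB; apply: IH => // v vB; apply: eB; right.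
(* Splitting the range at [l] puts bit [l] right after the free positions below [l], which is where
   [unpack] looks. *)
rewrite /pack (_ : n = l + (n - l.+1).+1)%N; last by lia.
rewrite iotaD filter_cat map_cat /= add0n.
rewrite -[X in is_free X B l](_ : n = l + (n - l.+1).+1)%N; last by lia.
by rewrite -(_ : n = l + (n - l.+1).+1)%N ?fl ?[in RHS]/=; [
  rewrite -catA nth_cat size_map size_filter ltnn subnn | lia].
Qed.

(** * Block hashing *)

(** Product over the two-element field of row [j] of a Hankel matrix, with entry [s (i + j)] in
    column [i], and the block of [u] that starts at [off]. *)
Fixpoint conv (s u : bits) (j off b : nat) : bool :=
  if b is i.+1 then conv s u j off i (+) (s (i + j)%N && u (off + i)%N) else false.

Definition hash (q m : nat) (s u : bits) : bits :=
  fun t => conv s u (t %% m) (t %/ m * (q * m)) (q * m).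

Lemma convD s u v j off b :
  conv s (addbits u v) j off b = conv s u j off b (+) conv s v j off b.
Proof.
elim: b => //= b ->; rewrite /addbits.
by case: (conv _ u _ _ _) (conv _ v _ _ _) (s _) (u _) (v _) => [] [] [] [] [].
Qed.

Lemma lead_max u n i : (lead u n < i < n)%N -> u i = false.
Proof.
elim: n => [|n IH] /=; first by rewrite andbF.
case: ifP => [un|un /andP[li]]; first by lia.
rewrite ltnS leq_eqVlt => /predU1P[-> //|ni]; apply: IH; exact/andP.
Qed.

(** Beyond the last one of the block all terms vanish, so the term at [i] stands alone as the seed
    bit [s (i + j)]. *)
Lemma conv_lead s u j off b :
  let i := lead (fun i => u (off + i)%N) b in
  (i < b)%N -> u (off + i)%N ->
  conv s u j off b = conv s u j off i (+) s (i + j)%N.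
Proof.
move=> i ib ui.
suff H d : (i < d <= b)%N -> conv s u j off d = conv s u j off i (+) s (i + j)%N.
  by apply: H; rewrite ib leqnn.
elim: d => // d IH; rewrite ltnS => /andP[id db] /=.
case: (eqVneq i d) => [<-|nid]; first by rewrite ui andbT.
rewrite IH; last by lia.
have -> : u (off + d)%N = false.
  by apply: (@lead_max (fun i => u (off + i)%N) b d); rewrite -/i; lia.
by rewrite andbF addbF.
Qed.

Lemma eq_conv s s' u j off b :
  (forall i, (i < b)%N -> s (i + j)%N = s' (i + j)%N) -> conv s u j off b = conv s' u j off b.
Proof.
elim: b => //= b IH H; rewrite IH ?H // => i ib; apply: H; exact: ltnW.
Qed.

Definition collide q m (s u v : bits) : bool :=
  all (fun t => hash q m s u t == hash q m s v t) (iota 0 (q * m)).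

(* A nonzero difference has a block whose last one sits at some [i < q * m];
   the seed bits at [i .. i + m - 1] are then determined by all the others. *)
Lemma card_collide q m n (u v : bits) :
  (0 < m)%N -> (n <= q * q * m)%N -> supported n u -> supported n v -> u <> v ->
  (#|[set r : (q * m + m).-tuple bool | collide q m (fun i => nth false r i) u v]%SET|
     <= 2 ^ (q * m))%N.
Proof.
move=> m0 nq su sv uv; set b := (q * m)%N; set w := addbits u v.
have [l wl] : exists l, w l.
  apply: contrapT => H; apply: uv; apply/funext => l.
  apply/eqP/negPn/negP => h; apply: H; exists l; rewrite /w /addbits.
  by move: h; case: (u l) (v l) => [] [].
have ln : (l < n)%N.
  by rewrite ltnNge; apply/negP => nl; rewrite /w /addbits su // sv in wl.
have b0 : (0 < b)%N by rewrite /b; nia.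
pose c := (l %/ b)%N; pose off := (c * b)%N.
have cq : (c < q)%N by rewrite ltn_divLR //; apply: leq_trans ln _; rewrite /b; nia.
pose i0 := lead (fun i => w (off + i)%N) b.
have [i0b wi0] : (i0 < b)%N /\ w (off + i0)%N.
  by apply: (@lead_lt (fun i => w (off + i)%N)); exists (l %% b)%N; rewrite ?ltn_mod // -divn_eq.
(* [phi] deletes the window of [m] bits starting at [i0]; its injectivity on [K] leaves at most
   [2 ^ b] colliding seeds. *)
pose phi (r : (b + m).-tuple bool) : b.-tuple bool :=
  [tuple nth false r (if (t < i0)%N then t : nat else t + m)%N | t < b].
rewrite -[X in (_ <= X ^ _)%N]card_bool -card_tuple.
set K := [set r | _]%SET.
(* By linearity the difference [w] hashes to 0; row [j] of block [c] then expresses seed bit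
   [i0 + j] through the bits [i + j] with [i < i0]. *)
have zero (r : (b + m).-tuple bool) j : r \in K -> (j < m)%N ->
    conv (fun i => nth false r i) w j off i0 = nth false r (i0 + j).
  rewrite inE => /allP H jm.
  have /H : (c * m + j)%N \in iota 0 (q * m) by rewrite mem_iota; nia.
  rewrite /hash divnMDl // modnMDl divn_small // modn_small // addn0 => /eqP e.
  have := convD (fun i => nth false r i) u v j off b; rewrite e addbb.
  rewrite -/w (@conv_lead _ w) //.
  by case: (conv _ _ _ _ _) (nth _ _ _) => [] [].
have inj : {in K &, injective phi}.
  move=> r r' rK r'K e.
  have out p : (p < i0)%N || (i0 + m <= p)%N -> nth false r p = nth false r' p.
    move=> Hp; case: (ltnP p (b + m)) => [pb|bp]; last first.
      by rewrite !nth_default ?size_tuple.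
    have pt : ((if (p < i0)%N then p else p - m) < b)%N by case: ifP Hp => /=; lia.
    have := congr1 (fun s => tnth s (Ordinal pt)) e; rewrite !tnth_mktuple /=.
    case: (ltnP p i0) Hp => /= [pi0 _|pi0 Hp]; first by rewrite pi0.
    by rewrite ifF ?subnK //; lia.
  (* The bits that determine bit [i0 + j] lie before the window or earlier inside it, so the window
     is recovered from left to right. *)
  have win j : (j < m)%N -> nth false r (i0 + j) = nth false r' (i0 + j).
    elim/ltn_ind: j => j IH jm; rewrite -!zero //; apply: eq_conv => i ii0.
    case: (ltnP (i + j) i0) => [h|h]; first by rewrite out ?h.
    by have e1 := IH (i + j - i0)%N; rewrite subnKC // in e1; apply: e1; lia.
  apply: eq_from_tnth => p; rewrite !(tnth_nth false).
  case: (boolP ((p < i0)%N || (i0 + m <= p)%N)) => [/out //|Hp].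
  move: Hp; rewrite negb_or -leqNgt -ltnNge => /andP[i0p pm].
  by have e1 := win (p - i0)%N; rewrite subnKC // in e1; apply: e1; lia.
rewrite -(card_in_imset inj); exact: max_card.
Qed.

(** Union bound over the candidates. *)
Lemma card_has_collide q m n (zs : seq bits) (u : bits) :
  (0 < m)%N -> (n <= q * q * m)%N -> supported n u ->
  (forall z, List.In z zs -> supported n z /\ z <> u) ->
  (#|[set r : (q * m + m).-tuple bool |
       has (fun z => collide q m (fun i => nth false r i) z u) zs]%SET|
     <= size zs * 2 ^ (q * m))%N.
Proof.
move=> m0 nq su; elim: zs => [|z zs IH] H /=.
  by rewrite leqn0 cards_eq0; apply/eqP/setP => r; rewrite !inE.
rewrite mulSn; apply: (leq_trans _ (leq_add _ (IH _))); last first.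
- by move=> w wz; apply: H; right.
- have [sz zu] := H z (or_introl erefl).
  exact: (card_collide m0 nq sz su zu).
rewrite -(cardsUI _ [set r | has _ zs]%SET) -[X in (X <= _)%N]addn0.
by apply: leq_add => //; apply: subset_leq_card; apply/fintype.subsetP => r; rewrite !inE.
Qed.

(** The ceiling of [sqrt (n / m)], as a search because the program tests successive squares. For
    positive [m] the value [n] always qualifies, so the range is long enough. *)
Definition block_count (n m : nat) : nat :=
  find (fun q => (n <= q * q * m)%N) (iota 0 n.+1).

Lemma block_countP n m : (0 < m)%N -> (n <= block_count n m * block_count n m * m)%N.
Proof.
move=> m0; have h : has (fun q => (n <= q * q * m)%N) (iota 0 n.+1).
  by apply/hasP; exists n; rewrite ?mem_iota; nia.
have := nth_find 0%N h; rewrite nth_iota //.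
by move: h; rewrite has_find size_iota.
Qed.

Lemma block_count_min n m q : (q < block_count n m)%N -> (q * q * m < n)%N.
Proof.
move=> h; have := before_find 0%N h; rewrite nth_iota ?add0n; first by lia.
by apply: leq_trans h _; rewrite -[X in (_ <= X)%N](size_iota 0) find_size.
Qed.

Lemma block_count_le n m : (0 < m)%N -> (block_count n m <= n)%N.
Proof.
move=> m0; case: (leqP (block_count n m) n) => // /block_count_min; nia.
Qed.

(** * Programs *)

(* Registers: 6 to 9 hold [m], [q], [b = q * m], [b + m]; 20 holds [k * n]; 18
   points into the message; 12 to 14 and 22 are loop counters.  Arrays: 5 lists the
   pivots, 6 flags them, 7 receives a hash, 8 holds [e].  The list decoder is
   relocated to the registers and arrays from 32 on. *)

Definition Xor (a b : expr) : expr := Add (Sub a b) (Sub b a).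

Lemma xor_nat (a b : bool) : (a - b + (b - a))%N = a (+) b.
Proof. by case: a b => [] []. Qed.

(** Chosen so that [2 ^ m] is at least [acc * L]; the successor keeps [m] positive, as block cutting
    requires. *)
Definition hash_width (acc L : nat) : nat := (up_log 2 acc + up_log 2 L).+1.

(** The logarithm is found by doubling register 10. Register 6 is incremented without being reset,
    so two calls add two logarithms. *)
Definition up_log_prog (x : nat) : prog :=
  Seq (Assign 10 (Cst 1))
    (While (Sub (Reg x) (Reg 10))
      (Seq (Assign 10 (Add (Reg 10) (Reg 10))) (Assign 6 (Add (Reg 6) (Cst 1))))).

Lemma up_log_runs x s a m : x \notin [:: 10%N; 6%N] -> reg s x = a -> reg s 6%N = m ->
  runs (up_log_prog x) s (up_log 2 a * 12 + 6)%N
    (fun s' => reg s' 6%N = m + up_log 2 a)%N.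
Proof.
rewrite !inE negb_or => /andP[x10 x6] xa xm.
apply: (@runs_leT _ _ (2 + (up_log 2 a * (4 + 8) + 4))%N); last by lia.
apply: runs_seq; apply: runs_assign => /=.
pose J i s1 := [/\ reg s1 6%N = (m + i)%N, reg s1 10%N = (2 ^ i)%N & reg s1 x = a].
apply: (@runs_post _ _ _ (J (up_log 2 a))); last by move=> s' [].
apply: (@runs_while (Sub (Reg x) (Reg 10)) _ _ 8 (up_log 2 a) J).
- by split=> //=; rewrite ?addn0 // (negbTE x10).
- move=> i s1 ia [h6 h10 hx] /=; split.
    rewrite hx h10 subn_eq0; apply/negP => ai.
    have := up_log_min (p := 2) isT ai; lia.
  apply: (@runs_leT _ _ (4 + 4)) => //.
  apply: runs_seq; apply: runs_assign => /=; apply: runs_assign => /=.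
  split=> /=; first by rewrite h6; lia.
  + by rewrite h10 expnS; lia.
  + by rewrite (negbTE x10) (negbTE x6).
- move=> s1 [_ h10 hx] /=; apply/eqP; rewrite hx h10 subn_eq0; exact: up_logP.
Qed.

(** Register 11 follows [q * q * m] through the increment [2 * q * m + m] between consecutive
    squares, register 8 holding [q * m]. *)
Definition params : prog :=
  Seq (Assign 6 (Cst 1))
 (Seq (up_log_prog 4)
 (Seq (up_log_prog 3)
 (Seq (Assign 7 (Cst 0))
 (Seq (Assign 8 (Cst 0))
 (Seq (Assign 11 (Cst 0))
 (Seq (While (Sub (Reg 0) (Reg 11))
        (Seq (Assign 11 (Add (Reg 11) (Add (Reg 8) (Add (Reg 8) (Reg 6)))))
        (Seq (Assign 8 (Add (Reg 8) (Reg 6)))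
             (Assign 7 (Add (Reg 7) (Cst 1))))))
      (Assign 9 (Add (Reg 8) (Reg 6))))))))).

Lemma params_runs s n L acc :
  reg s 0%N = n -> reg s 3%N = L -> reg s 4%N = acc ->
  let m := hash_width acc L in let q := block_count n m in
  runs params s (30 * (m + q + 1))%N
    (fun s' => [/\ reg s' 6%N = m, reg s' 7%N = q, reg s' 8%N = (q * m)%N
                 & reg s' 9%N = (q * m + m)%N]).
Proof.
move=> hn hL hacc m q.
apply: (@runs_leT _ _ (2 + ((up_log 2 acc * 12 + 6) + ((up_log 2 L * 12 + 6) +
  (2 + (2 + (2 + (q * (4 + 20) + 4 + 4)))))))%N); last by rewrite /m /hash_width; lia.
apply: runs_seq; apply: runs_assign => /=.
apply: (runs_seq_call (@up_log_runs 4%N _ acc 1%N _ _ _)) => //= s1 h1 k1.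
apply: (runs_seq_call (@up_log_runs 3%N _ L (1 + up_log 2 acc)%N _ _ _)) => //=.
  by rewrite (proj1 k1 3%N isT).
move=> s2; rewrite -addnA add1n -/(hash_width acc L) -/m => h2 k2.
apply: runs_seq; apply: runs_assign => /=.
apply: runs_seq; apply: runs_assign => /=.
apply: runs_seq; apply: runs_assign => /=.
have n2 : reg s2 0%N = n by rewrite (proj1 k2 0%N isT) (proj1 k1 0%N isT).
pose J i s' := [/\ reg s' 0%N = n, reg s' 6%N = m, reg s' 7%N = i, reg s' 8%N = (i * m)%N
  & reg s' 11%N = (i * i * m)%N].
apply: (@runs_seq_call _ _ _ _ _ (J q)); last first.
  move=> s3 [g0 g6 g7 g8 g11] _; apply: runs_assign => /=.
  by rewrite g6 g7 g8.
apply: (@runs_while (Sub (Reg 0) (Reg 11)) _ _ 20 q J).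
- by split.
- move=> i s3 iq [g0 g6 g7 g8 g11] /=; split.
    have := block_count_min iq; rewrite g0 g11; lia.
  apply: (@runs_leT _ _ (8 + (4 + 4))) => //.
  apply: runs_seq; apply: runs_assign => /=.
  apply: runs_seq; apply: runs_assign => /=.
  apply: runs_assign; split=> //=; rewrite ?g11 ?g6 ?g7 ?g8; lia.
- move=> s3 [g0 g6 g7 g8 g11] /=; apply/eqP; rewrite g0 g11 subn_eq0.
  exact: block_countP.
Qed.

(** * Gaussian elimination on the machine *)

Definition holds_rows n K (rows : nat -> bits) (a : nat -> nat) : Prop :=
  forall i l, (i < K)%N -> (l < n)%N -> a (i * n + l)%N = rows i l.

Lemma cell_eq n i l i' l' : (l < n)%N -> (l' < n)%N ->
  ((i * n + l)%N == (i' * n + l')%N) = (i == i') && (l == l').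
Proof.
move=> ln l'n; apply/eqP/andP => [e|[/eqP-> /eqP->] //].
have n0 : (0 < n)%N by lia.
have := congr1 (divn^~ n) e; have := congr1 (modn^~ n) e.
rewrite !modnMDl !modn_small // !divnMDl // !divn_small // !addn0 => -> ->.
by rewrite !eqxx.
Qed.

Definition row_base : prog :=
  Seq (Assign 20 (Cst 0)) (For 12 (Reg 1) (Assign 20 (Add (Reg 20) (Reg 0)))).

Lemma row_base_runs s k n : reg s 0%N = n -> reg s 1%N = k ->
  runs row_base s (k * 12 + 8)%N (fun s' => reg s' 20%N = (k * n)%N).
Proof.
move=> h0 h1; apply: (@runs_leT _ _ (2 + (k * (1 + 4 + 7) + (1 + 5)))%N); last by lia.
apply: runs_seq; apply: runs_assign => /=.
pose J i s' := reg s' 20%N = (i * n)%N.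
apply: (@runs_post _ _ _ (fun s' => J k s' /\ reg s' 12%N = k)); last by move=> ? [].
apply: (@runs_for 12 (Reg 1) _ _ 4 k J) => // [s1 k1|i s1 ik k1 _ J1].
  by rewrite /= (proj1 k1 1%N isT).
apply: runs_assign => /=; rewrite /J /= J1 (proj1 k1 0%N isT) /= h0; lia.
Qed.

Definition load_row : prog :=
  For 14 (Reg 0) (Store 0 (Add (Reg 20) (Reg 14)) (Get 1 (Reg 14))).

Lemma load_row_runs s n k (rows : nat -> bits) (x : bits) :
  reg s 0%N = n -> reg s 20%N = (k * n)%N -> holds_rows n k rows (arr s 0%N) ->
  (forall l, arr s 1%N l = x l) ->
  runs load_row s (n * 14 + 6)%N (fun s' =>
    holds_rows n k.+1 (fun i => if i == k then x else rows i) (arr s' 0%N)).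
Proof.
move=> h0 h20 h hx.
apply: (@runs_leT _ _ (n * (1 + 6 + 7) + (1 + 5))%N); last by lia.
pose J l s' := forall i l', (i <= k)%N -> (l' < n)%N ->
  (i < k)%N || (l' < l)%N ->
  arr s' 0%N (i * n + l')%N = (if i == k then x else rows i) l'.
apply: (@runs_post _ _ _ (fun s' => J n s' /\ reg s' 14%N = n)).
  apply: (@runs_for 14 (Reg 0) _ _ 6 n J) => // [s1 k1||l s1 ln k1 h14 J1].
  - by rewrite /= (proj1 k1 0%N isT).
  - move=> i l ik ln; rewrite ltn0 orbF => ik'; rewrite /= h //.
    by rewrite (ltn_eqF ik').
  - apply: runs_store => /= i l' ik l'n /= H.
    rewrite (proj1 k1 20%N isT) h20 h14 cell_eq // (proj2 k1 1%N isT) /= hx.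
    case: (eqVneq i k) => [ik1|ik1] /=.
      case: (eqVneq l' l) => [->|ll] //=.
      by rewrite J1 //; [rewrite ik1 eqxx | lia].
    by rewrite J1 //; [rewrite (negbTE ik1) | lia].
by move=> s' [J1 _] i l ik ln; apply: J1 => //; rewrite ln orbT.
Qed.

(** Registers 15 and 16 hold the base addresses of the row being cleared and of the row added to it;
    array 5 gives the pivot of the latter. *)
Definition clear_step : prog :=
  Seq (If (Get 0 (Add (Reg 15) (Get 5 (Reg 13))))
         (For 14 (Reg 0) (Store 0 (Add (Reg 15) (Reg 14))
            (Xor (Get 0 (Add (Reg 15) (Reg 14))) (Get 0 (Add (Reg 16) (Reg 14))))))
         Skip)
      (Assign 16 (Add (Reg 16) (Reg 0))).

Lemma clear_step_runs s n K i j (M : nat -> bits) :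
  reg s 0%N = n -> reg s 15%N = (i * n)%N -> reg s 16%N = (j * n)%N ->
  arr s 5%N (reg s 13%N) = lead (M j) n -> (lead (M j) n < n)%N ->
  (i < K)%N -> (j < K)%N -> i != j -> holds_rows n K M (arr s 0%N) ->
  runs clear_step s (n * 31 + 17)%N (fun s' => reg s' 16%N = (j.+1 * n)%N /\
    holds_rows n K (fun i' => if i' == i then clear n (M i) (M j) else M i') (arr s' 0%N)).
Proof.
move=> h0 h15 h16 h5 ln iK jK ij h.
apply: (@runs_leT _ _ (5.+1 + (n * (1 + 23 + 7) + (1 + 5) + 1) + 4)%N); last by lia.
apply: runs_seq; apply: runs_if => /=; rewrite h5 h15 h //.
- rewrite eqb0 negbK => Mi.
  pose J l s' := holds_rows n K (fun i' l' => if (i' == i) && (l' < l)%N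
     then addbits (M i) (M j) l' else M i' l') (arr s' 0%N).
  apply: (@runs_call _ _ _ _ (fun s' => J n s' /\ reg s' 14%N = n) _ _ (leqnn _)).
    apply: (@runs_for 14 (Reg 0) _ _ 23 n J) => // [s1 k1||l s1 l_n k1 h14 J1].
    + by rewrite /= (proj1 k1 0%N isT).
    + by move=> i' l' i'K l'n; rewrite ltn0 andbF /= h.
    + apply: runs_store => /= i' l' i'K l'n /=.
      rewrite (proj1 k1 15%N isT) (proj1 k1 16%N isT) h15 h16 h14 cell_eq //.
      rewrite !J1 // ltnn !andbF xor_nat.
      case: (eqVneq i' i) => [->|_] //=.
      case: (eqVneq l' l) => [->|l'l] /=; first by rewrite ltnS leqnn.
      by rewrite ltnS [in RHS]leq_eqVlt (negbTE l'l).
  move=> s1 [J1 _] k1; apply: runs_assign => /=; split.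
    by rewrite (proj1 k1 16%N isT) (proj1 k1 0%N isT) h16 h0; lia.
  move=> i' l' i'K l'n; rewrite J1 // l'n andbT /clear Mi; by case: eqP.
- move=> /eqP; rewrite eqb0 => Mi; apply: runs_skip; apply: runs_assign => /=; split.
    by rewrite h16 h0; lia.
  move=> i' l' i'K l'n; rewrite h // /clear (negbTE Mi); by case: eqP => [->|].
Qed.

Definition clear_row : prog :=
  Seq (Assign 16 (Cst 0)) (For 13 (Reg 12) clear_step).

Definition find_pivot : prog :=
  For 14 (Reg 0) (If (Get 0 (Add (Reg 15) (Reg 14))) (Store 5 (Reg 12) (Reg 14)) Skip).

Definition eliminated n rows i (i' : nat) : bits :=
  if (i' < i)%N then reduced n rows i' else rows i'.

Lemma clear_row_runs s n K i (rows : nat -> bits) :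
  reg s 0%N = n -> reg s 12%N = i -> reg s 15%N = (i * n)%N -> (i < K)%N ->
  (forall j, (j < i)%N -> arr s 5%N j = lead (reduced n rows j) n) ->
  (forall j, (j < i)%N -> lead (reduced n rows j) n < n)%N ->
  holds_rows n K (eliminated n rows i) (arr s 0%N) ->
  runs clear_row s (i * (n * 31 + 25) + 8)%N (fun s' =>
    holds_rows n K (eliminated n rows i.+1) (arr s' 0%N)).
Proof.
move=> h0 h12 h15 iK h5 hl h.
apply: (@runs_leT _ _ (2 + (i * (1 + (n * 31 + 17) + 7) + (1 + 5)))%N); last by lia.
apply: runs_seq; apply: runs_assign => /=.
pose N j i' := if i' == i then foldl (clear n) (rows i) (reduced_rows n rows j)
  else eliminated n rows i i'.
pose J j s' := reg s' 16%N = (j * n)%N /\ holds_rows n K (N j) (arr s' 0%N).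
apply: (@runs_post _ _ _ (fun s' => J i s' /\ reg s' 13%N = i)).
  apply: (@runs_for 13 (Reg 12) _ _ _ i J) => // [s1 k1||j s1 ji k1 h13 [J1 J2]].
  - by rewrite /= (proj1 k1 12%N isT).
  - split=> // i' l i'K ln; rewrite /= h // /N /eliminated /=.
    by case: (eqVneq i' i) => // ->; rewrite ltnn.
  - have Nj : N j j = reduced n rows j.
      by rewrite /N (ltn_eqF ji) /eliminated ji.
    apply: (@runs_post _ _ _ (fun s' => reg s' 16%N = (j.+1 * n)%N /\
      holds_rows n K (fun i' => if i' == i then clear n (N j i) (N j j) else N j i') (arr s' 0%N))).
      apply: clear_step_runs => //; rewrite ?Nj ?h13 ?(proj1 k1 0%N isT) ?(proj1 k1 15%N isT)
        ?(proj2 k1 5%N isT) /= ?h5 ?hl //; [exact: ltn_trans ji iK|].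
      by rewrite neq_ltn ji orbT.
    move=> s' [g1 g2]; split=> // i' l i'K ln; rewrite /= g2 //.
    by rewrite Nj /N eqxx /= foldl_rcons -/(reduced n rows j); case: eqP.
move=> s' [[_ J2] _] i' l i'K ln; rewrite J2 // /N /eliminated ltnS.
by case: ltngtP => // ->.
Qed.

(** A row without ones leaves its cell untouched; the hypothesis [p i = 0] makes that agree with the
    default of [lead]. *)
Lemma find_pivot_runs s n i (u : bits) (p : nat -> nat) :
  reg s 0%N = n -> reg s 12%N = i -> reg s 15%N = (i * n)%N ->
  (forall l, (l < n)%N -> arr s 0%N (i * n + l)%N = u l) ->
  arr s 5%N = p -> p i = 0%N ->
  runs find_pivot s (n * 17 + 6)%N (fun s' =>
    forall j, arr s' 5%N j = if j == i then lead u n else p j).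
Proof.
move=> h0 h12 h15 h h5 pi0.
apply: (@runs_leT _ _ (n * (1 + (4.+1 + (3 + 1)) + 7) + (1 + 5))%N); last by lia.
pose J l s' := forall j, arr s' 5%N j = if j == i then lead u l else p j.
apply: (@runs_post _ _ _ (fun s' => J n s' /\ reg s' 14%N = n)); last by move=> ? [].
apply: (@runs_for 14 (Reg 0) _ _ _ n J) => // [s1 k1||l s1 ln k1 h14 J1].
- by rewrite /= (proj1 k1 0%N isT).
- by move=> j; rewrite /= h5; case: eqP => // ->.
- apply: runs_if => /=; rewrite (proj1 k1 15%N isT) (proj2 k1 0%N isT) h15 h14 h //.
  + rewrite eqb0 negbK => ul; apply: runs_store => j /=.
    by rewrite (proj1 k1 12%N isT) h12 h14 ul J1; case: eqP.
  + move=> /eqP; rewrite eqb0 => /negbTE ul; apply: runs_skip => j /=.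
    by rewrite ul.
Qed.

(** The bound is [k + 1] because the input word sits in row [k]. Its own lead also lands in array 5,
    at index [k], where [mark_pivots] does not read. *)
Definition eliminate : prog :=
  Seq (Assign 15 (Cst 0))
    (For 12 (Add (Reg 1) (Cst 1))
       (Seq clear_row (Seq find_pivot (Assign 15 (Add (Reg 15) (Reg 0)))))).

Lemma eliminate_runs s n k (rows : nat -> bits) :
  reg s 0%N = n -> reg s 1%N = k ->
  (forall i, arr s 5%N i = 0%N) ->
  (forall i, (i < k)%N -> lead (reduced n rows i) n < n)%N ->
  holds_rows n k.+1 rows (arr s 0%N) ->
  runs eliminate s ((k.+1 * (k.+1 * (n * 60 + 60))))%N (fun s' =>
    holds_rows n k.+1 (reduced n rows) (arr s' 0%N) /\
    forall i, (i < k)%N -> arr s' 5%N i = lead (reduced n rows i) n).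
Proof.
move=> h0 h1 h5 hl h.
apply: (@runs_leT _ _ (2 + (k.+1 * (3 + ((k * (n * 31 + 25) + 8) + ((n * 17 + 6) + 4)) + 7)
   + (3 + 5)))%N); last by nia.
apply: runs_seq; apply: runs_assign => /=.
pose J i s' := [/\ reg s' 15%N = (i * n)%N, holds_rows n k.+1 (eliminated n rows i) (arr s' 0%N)
  & forall j, arr s' 5%N j = if (j < i)%N then lead (reduced n rows j) n else 0%N].
apply: (@runs_post _ _ _ (fun s' => J k.+1 s' /\ reg s' 12%N = k.+1)).
  apply: (@runs_for 12 (Add (Reg 1) (Cst 1)) _ _ _ k.+1 J) => // [s1 k1|i s1 ik k1 h12 [J1 J2 J3]].
  - by rewrite /= (proj1 k1 1%N isT) /= h1 addn1.
  - have g0 : reg s1 0%N = n by rewrite (proj1 k1 0%N isT).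
    apply: runs_seq; apply: (@runs_call _ _ (i * (n * 31 + 25) + 8)%N _ _ _
      (@clear_row_runs s1 n k.+1 i rows _ _ _ _ _ _ _)) => //.
    + by move=> j ji; rewrite J3 ji.
    + by move=> j ji; apply: hl; lia.
    + by nia.
    move=> s2 g2 k2; apply: runs_seq.
    apply: (@runs_call _ _ _ _ _ _ (@find_pivot_runs s2 n i (reduced n rows i) (arr s1 5%N)
      _ _ _ _ _ _) (leqnn _)).
    + by rewrite (proj1 k2 0%N isT).
    + by rewrite (proj1 k2 12%N isT).
    + by rewrite (proj1 k2 15%N isT).
    + by move=> l ln; rewrite g2 // /eliminated ltnSn.
    + by rewrite (proj2 k2 5%N isT).
    + by rewrite J3 ltnn.
    move=> s3 g3 k3; apply: runs_assign => /=; split=> /=.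
    + rewrite (proj1 k3 15%N isT) (proj1 k3 0%N isT) (proj1 k2 15%N isT).
      by rewrite (proj1 k2 0%N isT) J1 g0; lia.
    + by rewrite (proj2 k3 0%N isT).
    + by move=> j; rewrite g3 J3 ltnS; case: ltngtP => // ->.
move=> s' [[_ J2 J3] _]; split.
  by move=> i l ik ln; rewrite J2 // /eliminated ik.
by move=> i ik; rewrite J3 ltnS ltnW.
Qed.

Definition mark_pivots : prog := For 12 (Reg 1) (Store 6 (Get 5 (Reg 12)) (Cst 1)).

Lemma mark_pivots_runs s n k (rows : nat -> bits) :
  reg s 1%N = k -> (forall l, arr s 6%N l = 0%N) ->
  (forall i, (i < k)%N -> arr s 5%N i = lead (reduced n rows i) n) ->
  runs mark_pivots s (k * 12 + 6)%N
    (fun s' => forall l, arr s' 6%N l = ~~ is_free n (reduced_rows n rows k) l).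
Proof.
move=> h1 h6 h5.
apply: (@runs_leT _ _ (k * (1 + 4 + 7) + (1 + 5))%N); last by lia.
pose J i s' := forall l, arr s' 6%N l = ~~ is_free n (reduced_rows n rows i) l.
apply: (@runs_post _ _ _ (fun s' => J k s' /\ reg s' 12%N = k)); last by move=> ? [].
apply: (@runs_for 12 (Reg 1) _ _ _ k J) => // [s1 k1|i s1 ik k1 h12 J1].
- by rewrite /= (proj1 k1 1%N isT).
- apply: runs_store => l /=; rewrite h12 (proj2 k1 5%N isT) /= h5 // J1.
  rewrite /is_free /= map_rcons mem_rcons inE !negbK -/(reduced n rows i).
  by case: eqP.
Qed.

(** * Hashing on the machine *)

Definition hash_bit : prog :=
  Seq (Assign 17 (Cst 0))
 (Seq (For 14 (Reg 8)
        (If (Get 2 (Add (Reg 14) (Reg 13)))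
           (Assign 17 (Xor (Reg 17) (Get 1 (Add (Reg 15) (Reg 14))))) Skip))
 (Seq (Store 7 (Reg 21) (Reg 17))
      (Assign 21 (Add (Reg 21) (Cst 1))))).

(** The nested counters are the quotient and the remainder of [t] by [m] in [hash], so no division
    is performed; register 15 follows the start of the block. *)
Definition hash_prog : prog :=
  Seq (Assign 21 (Cst 0))
 (Seq (Assign 15 (Cst 0))
      (For 12 (Reg 7)
        (Seq (For 13 (Reg 6) hash_bit)
             (Assign 15 (Add (Reg 15) (Reg 8)))))).

Lemma hash_bit_runs st (s u : bits) j off b pos (h : nat -> nat) :
  reg st 8%N = b -> reg st 13%N = j -> reg st 15%N = off -> reg st 21%N = pos ->
  (forall i, arr st 2%N i = s i) -> (forall i, arr st 1%N i = u i) -> arr st 7%N = h ->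
  runs hash_bit st (b * 28 + 15)%N (fun st' => reg st' 21%N = pos.+1 /\
    forall i, arr st' 7%N i = if i == pos then nat_of_bool (conv s u j off b) else h i).
Proof.
move=> h8 h13 h15 h21 h2 h1 h7.
apply: (@runs_leT _ _ (2 + ((b * (1 + (4.+1 + (14 + 1)) + 7) + (1 + 5)) + (3 + 4)))%N); last by lia.
apply: runs_seq; apply: runs_assign => /=.
pose J i s' := reg s' 17%N = conv s u j off i.
apply: runs_seq; apply: (@runs_call _ _ _ _ (fun s' => J b s' /\ reg s' 14%N = b) _ _ (leqnn _)).
  apply: (@runs_for 14 (Reg 8) _ _ _ b J) => // [s1 k1|i s1 ib k1 h14 J1].
    by rewrite /= (proj1 k1 8%N isT).
  apply: runs_if => /=; rewrite (proj2 k1 2%N isT) (proj1 k1 13%N isT) h14 /= h2 h13.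
  + rewrite eqb0 negbK => si; apply: (@runs_leT _ _ 14) => //; apply: runs_assign => /=.
    by rewrite /J /= J1 (proj2 k1 1%N isT) (proj1 k1 15%N isT) h14 /= h1 h15 xor_nat si.
  + move=> /eqP; rewrite eqb0 => /negbTE si; apply: runs_skip.
    by rewrite /J /= J1 si addbF.
move=> s1 [J1 _] k1; apply: runs_seq; apply: runs_store => /=.
apply: runs_assign => /=; split.
  by rewrite (proj1 k1 21%N isT) /= h21 addn1.
by move=> i; rewrite J1 (proj1 k1 21%N isT) (proj2 k1 7%N isT) /= h21 h7; case: eqP.
Qed.

Lemma hash_runs st (s u : bits) q m :
  reg st 6%N = m -> reg st 7%N = q -> reg st 8%N = (q * m)%N ->
  (forall i, arr st 2%N i = s i) -> (forall i, arr st 1%N i = u i) ->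
  runs hash_prog st (q * (m * (q * m * 28 + 23) + 18) + 10)%N (fun st' =>
    forall t, (t < q * m)%N -> arr st' 7%N t = hash q m s u t).
Proof.
move=> h6 h7 h8 h2 h1.
apply: (@runs_leT _ _ (2 + (2 + (q * (1 + ((m * (1 + (q * m * 28 + 15) + 7) + (1 + 5)) + 4) + 7)
  + (1 + 5))))%N); last by lia.
apply: runs_seq; apply: runs_assign => /=.
apply: runs_seq; apply: runs_assign => /=.
pose J p s' := reg s' 21%N = p /\ forall t, (t < p)%N -> arr s' 7%N t = hash q m s u t.
pose J1 c s' := J (c * m)%N s' /\ reg s' 15%N = (c * (q * m))%N.
apply: (@runs_post _ _ _ (fun s' => J1 q s' /\ reg s' 12%N = q)); last by move=> s' [[[]]].
apply: (@runs_for 12 (Reg 7) _ _ _ q J1) => // [s1 k1|c s1 cq k1 h12 [[g21 g7] g15]].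
- by rewrite /= (proj1 k1 7%N isT).
apply: runs_seq; pose J2 j s' := J (c * m + j)%N s'.
apply: (@runs_call _ _ _ _ (fun s' => J2 m s' /\ reg s' 13%N = m) _ _ (leqnn _)).
  apply: (@runs_for 13 (Reg 6) _ _ _ m J2) => // [s2 k2||j s2 jm k2 h13 [g21' g7']].
  - by rewrite /= (proj1 k2 6%N isT) (proj1 k1 6%N isT).
  - by split=> [|t] /=; rewrite addn0 //; exact: g7.
  - apply: (@runs_post _ _ _ (fun st' => reg st' 21%N = (c * m + j).+1 /\
      forall i, arr st' 7%N i = if i == (c * m + j)%N
        then nat_of_bool (conv s u j (c * (q * m)) (q * m)) else arr s2 7%N i)).
      apply: hash_bit_runs => //.
      + by rewrite (proj1 k2 8%N isT) (proj1 k1 8%N isT).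
      + by rewrite (proj1 k2 15%N isT).
      + by move=> i; rewrite (proj2 k2 2%N isT) (proj2 k1 2%N isT); exact: h2.
      + by move=> i; rewrite (proj2 k2 1%N isT) (proj2 k1 1%N isT); exact: h1.
    move=> s3 [f21 f7]; split=> /=; first by rewrite f21 addnS.
    move=> t; rewrite addnS ltnS leq_eqVlt f7 => /predU1P[->|tl].
      rewrite eqxx /hash divnMDl ?modnMDl ?divn_small ?modn_small ?addn0 //.
      by apply: leq_ltn_trans jm.
    by rewrite (ltn_eqF tl) g7'.
move=> s2 [[f21 f7] _] k2; apply: runs_assign => /=; split=> /=.
  by split=> /= [|t]; rewrite mulSn addnC //; exact: f7.
by rewrite (proj1 k2 15%N isT) (proj1 k2 8%N isT) (proj1 k1 8%N isT) g15 /= h8 mulSn addnC.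
Qed.

(** * The input word as an additional row *)

Definition with_row k (rows : nat -> bits) (x : bits) : nat -> bits :=
  fun i => if i == k then x else rows i.

Definition syndrome k n (G : 'M['F_2]_(k, n)) (x : bits) : bits :=
  foldl (clear n) x (reduced_rows n (matrix_rows G) k).

Lemma reduced_rows_with_row n k (rows : nat -> bits) x i : (i <= k)%N ->
  reduced_rows n (with_row k rows x) i = reduced_rows n rows i.
Proof.
move=> ik; apply: eq_reduced_rows => j ji; rewrite /with_row ltn_eqF //.
exact: leq_trans ji ik.
Qed.

Lemma reduced_with_row n k rows x i : (i < k)%N ->
  reduced n (with_row k rows x) i = reduced n rows i.
Proof. by move=> ik; rewrite /reduced reduced_rows_with_row 1?ltnW // /with_row ltn_eqF. Qed.

Lemma reduced_last n k rows x :
  reduced n (with_row k rows x) k = foldl (clear n) x (reduced_rows n rows k).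
Proof. by rewrite /reduced reduced_rows_with_row // /with_row eqxx. Qed.

(* The input word is row [k]: eliminating it like the others yields [e]. *)
Definition analyse : prog :=
  Seq params (Seq load_row (Seq eliminate mark_pivots)).

Definition analyse_time k n m q : nat :=
  (30 * (m + q + 1) + ((n * 14 + 6) + (k.+1 * (k.+1 * (n * 60 + 60)) + (k * 12 + 6))))%N.

Lemma analyse_runs k n (G : 'M['F_2]_(k, n)) s L acc (x : bits) :
  row_free G ->
  reg s 0%N = n -> reg s 1%N = k -> reg s 3%N = L -> reg s 4%N = acc ->
  reg s 20%N = (k * n)%N -> arr s 0%N = cells G -> (forall l, arr s 1%N l = x l) ->
  (forall i, arr s 5%N i = 0%N) -> (forall i, arr s 6%N i = 0%N) ->
  let m := hash_width acc L in let q := block_count n m in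
  runs analyse s (analyse_time k n m q) (fun s' =>
    [/\ reg s' 6%N = m, reg s' 7%N = q, reg s' 8%N = (q * m)%N & reg s' 9%N = (q * m + m)%N] /\
    (forall l, (l < n)%N -> arr s' 0%N (k * n + l)%N = syndrome G x l) /\
    (forall l, arr s' 6%N l = ~~ is_free n (reduced_rows n (matrix_rows G) k) l)).
Proof.
move=> Gf h0 h1 h3 h4 h20 a0 a1 a5 a6 m q.
apply: (runs_seq_call (params_runs h0 h3 h4)) => s1 [g6 g7 g8 g9] k1.
have H0 : holds_rows n k (matrix_rows G) (arr s1 0%N).
  by move=> i l ik ln; rewrite (proj2 k1 0%N isT) a0 cells_matrix.
apply: (runs_seq_call (@load_row_runs s1 n k (matrix_rows G) x _ _ H0 _)).
- by rewrite (proj1 k1 0%N isT).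
- by rewrite (proj1 k1 20%N isT).
- by move=> l; rewrite (proj2 k1 1%N isT).
rewrite -/(with_row k (matrix_rows G) x) => s2 H1 k2.
apply: (runs_seq_call (@eliminate_runs s2 n k (with_row k (matrix_rows G) x) _ _ _ _ H1)).
- by rewrite (proj1 k2 0%N isT) (proj1 k1 0%N isT).
- by rewrite (proj1 k2 1%N isT) (proj1 k1 1%N isT).
- by move=> i; rewrite (proj2 k2 5%N isT) (proj2 k1 5%N isT).
- by move=> i ik; rewrite reduced_with_row //; have /andP[] := reduced_lead Gf ik.
move=> s3 [H2 H3] k3.
apply: (runs_call (@mark_pivots_runs s3 n k (with_row k (matrix_rows G) x) _ _ _) (leqnn _)).
- by rewrite (proj1 k3 1%N isT) (proj1 k2 1%N isT) (proj1 k1 1%N isT).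
- by move=> i; rewrite (proj2 k3 6%N isT) (proj2 k2 6%N isT) (proj2 k1 6%N isT).
- exact: H3.
move=> s4; rewrite reduced_rows_with_row // => H4 k4; split; last split=> //.
  have R i : i \in [:: 6; 7; 8; 9]%N -> reg s4 i = reg s1 i.
    move=> ii; have [p2 p3 p4] : [/\ i \notin wregs load_row, i \notin wregs eliminate
        & i \notin wregs mark_pivots].
      by move: ii; rewrite !inE => /or4P[] /eqP ->.
    by rewrite (proj1 k4 _ p4) (proj1 k3 _ p3) (proj1 k2 _ p2).
  by rewrite !R.
by move=> l ln; rewrite (proj2 k4 0%N isT) H2 // reduced_last.
Qed.

(** * The sender *)

Definition push (e : expr) : prog :=
  Seq (Store 3 (Reg 5) e) (Assign 5 (Add (Reg 5) (Cst 1))).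

Lemma push_runs s l e (b : bool) : outputs_message s l -> eval s e = b ->
  runs (push e) s (ecost e + 6)%N (fun s' => outputs_message s' (rcons l b)).
Proof.
move=> [h5 h3] eb; apply: (@runs_leT _ _ ((1 + ecost e).+1 + 4)%N); last by lia.
rewrite /reg_count /arr_msg in h5 h3.
apply: runs_seq; apply: runs_store => /=; apply: runs_assign; split=> /=.
  by rewrite /reg_count size_rcons h5 addn1.
move=> i; rewrite size_rcons ltnS leq_eqVlt eb nth_rcons h5 => /predU1P[->|il].
  by rewrite eqxx ltnn.
by rewrite (ltn_eqF il) il /= -h3.
Qed.

Lemma push_loop_runs s l e bound N (f : bits) :
  outputs_message s l ->
  (forall s1, keeps (For 14 bound (push e)) s s1 -> eval s1 bound = N) ->
  (forall s1 i, (i < N)%N -> keeps (For 14 bound (push e)) s s1 -> reg s1 14%N = i ->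
     eval s1 e = f i) ->
  runs (For 14 bound (push e)) s (N * (ecost bound + (ecost e + 6) + 7) + (ecost bound + 5))%N
    (fun s' => outputs_message s' (l ++ mkseq f N)).
Proof.
move=> hl hb he.
pose J i s' := outputs_message s' (l ++ mkseq f i).
apply: (@runs_post _ _ _ (fun s' => J N s' /\ reg s' 14%N = N)); last by move=> ? [].
apply: runs_for => //; first by rewrite /J cats0.
move=> i s1 iN k1 h14 J1.
apply: (runs_post (push_runs J1 (he _ _ iN k1 h14))) => s2.
by rewrite rcons_cat -mkseqS.
Qed.

Definition emit_syndrome : prog :=
  For 14 (Reg 0) (If (Get 6 (Reg 14)) Skip (push (Get 0 (Add (Reg 20) (Reg 14))))).

Lemma emit_syndrome_runs s n p B (e : bits) :
  reg s 0%N = n -> reg s 20%N = p -> outputs_message s [::] ->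
  (forall l, (l < n)%N -> arr s 0%N (p + l)%N = e l) ->
  (forall l, arr s 6%N l = ~~ is_free n B l) ->
  runs emit_syndrome s (n * 22 + 6)%N (fun s' => outputs_message s' (pack n B e)).
Proof.
move=> h0 h20 hm he h6.
apply: (@runs_leT _ _ (n * (1 + (2.+1 + (1 + 10)) + 7) + (1 + 5))%N); last by lia.
pose J i s' := outputs_message s' [seq e l | l <- iota 0 i & is_free n B l].
apply: (@runs_post _ _ _ (fun s' => J n s' /\ reg s' 14%N = n)); last by move=> ? [].
apply: (@runs_for 14 (Reg 0) _ _ _ n J) => // [s1 k1|i s1 iN k1 h14 J1].
  by rewrite /= (proj1 k1 0%N isT).
have Ji : iota 0 i.+1 = rcons (iota 0 i) i by rewrite -addn1 iotaD cats1.
apply: runs_if => /=; rewrite (proj2 k1 6%N isT) h14 h6.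
- rewrite eqb0 negbK => fi; apply: runs_skip.
  by rewrite /J Ji filter_rcons (negbTE fi); exact: J1.
- move=> /eqP; rewrite eqb0 negbK => fi.
  have ev : eval s1 (Get 0 (Add (Reg 20) (Reg 14))) = e i.
    by rewrite /= (proj2 k1 0%N isT) (proj1 k1 20%N isT) h14 h20 he.
  apply: (runs_post (push_runs J1 ev)) => s2.
  by rewrite /J Ji filter_rcons fi map_rcons.
Qed.

Definition alice : prog :=
  Seq row_base (Seq analyse (Seq hash_prog
    (Seq emit_syndrome
    (Seq (For 14 (Reg 9) (push (Get 2 (Reg 14))))
         (For 14 (Reg 8) (push (Get 7 (Reg 14)))))))).

Definition hash_time q m : nat := (q * (m * (q * m * 28 + 23) + 18) + 10)%N.

Definition alice_time k n m q : nat :=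
  ((k * 12 + 8) + (analyse_time k n m q + (hash_time q m + ((n * 22 + 6) +
    (((q * m + m) * 16 + 6) + (q * m * 16 + 6))))))%N.

Definition message k n (G : 'M['F_2]_(k, n)) q m (x : 'rV['F_2]_n) (r : seq bool) : seq bool :=
  pack n (reduced_rows n (matrix_rows G) k) (syndrome G (bits_of x))
    ++ (r ++ mkseq (hash q m (fun i => nth false r i) (bits_of x)) (q * m)).

Lemma alice_runs k n (G : 'M['F_2]_(k, n)) radius L acc x r :
  let m := hash_width acc L in let q := block_count n m in
  row_free G -> size r = (q * m + m)%N ->
  runs alice (alice_input (code_state radius L G) acc x r) (alice_time k n m q)
    (fun s' => outputs_message s' (message G q m x r)).
Proof.
move=> m q Gf sr; set s := alice_input _ _ _ _.
apply: (runs_seq_call (@row_base_runs s k n erefl erefl)) => s1 g20 k1.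
have A1 : arr s1 1%N = (fun i => bits_of x i : nat).
  by rewrite (proj2 k1 1%N isT) /= cells_row.
have A2 : arr s1 2%N = (fun i => nth false r i : nat) by rewrite (proj2 k1 2%N isT).
have R i : i \in [:: 0; 1; 3; 4]%N -> reg s1 i = reg s i.
  by move=> ii; rewrite (proj1 k1) //; move: ii; rewrite !inE => /or4P[] /eqP ->.
apply: (runs_seq_call (@analyse_runs k n G s1 L acc (bits_of x) Gf _ _ _ _ g20 _ _ _ _));
  rewrite ?R //.
- by rewrite (proj2 k1 0%N isT).
- by move=> l; rewrite A1.
- by move=> l; rewrite (proj2 k1 5%N isT).
- by move=> l; rewrite (proj2 k1 6%N isT).
rewrite -/m -/q => s2 [[g6 g7 g8 g9] [H0 H6]] k2.
apply: (runs_seq_call (@hash_runs s2 (fun i => nth false r i) (bits_of x) q m g6 g7 g8 _ _)).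
- by move=> i; rewrite (proj2 k2 2%N isT) A2.
- by move=> i; rewrite (proj2 k2 1%N isT) A1.
move=> s3 H7 k3.
apply: (runs_seq_call (@emit_syndrome_runs s3 n (k * n) (reduced_rows n (matrix_rows G) k)
   (syndrome G (bits_of x)) _ _ _ _ _)).
- by rewrite (proj1 k3 0%N isT) (proj1 k2 0%N isT) (proj1 k1 0%N isT).
- by rewrite (proj1 k3 20%N isT) (proj1 k2 20%N isT).
- split=> //; rewrite /reg_count.
  by rewrite (proj1 k3 5%N isT) (proj1 k2 5%N isT) (proj1 k1 5%N isT).
- by move=> l ln; rewrite (proj2 k3 0%N isT) H0.
- by move=> l; rewrite (proj2 k3 6%N isT) H6.
move=> s4 H4 k4.
apply: (@runs_seq_call _ _ _ _ _ _ _ (@push_loop_runs s4 _ (Get 2 (Reg 14)) (Reg 9)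
  (q * m + m) (fun i => nth false r i) H4 _ _)).
- move=> s5 k5.
  by rewrite /= (proj1 k5 9%N isT) (proj1 k4 9%N isT) (proj1 k3 9%N isT).
- move=> s5 i _ k5 h14.
  by rewrite /= h14 (proj2 k5 2%N isT) (proj2 k4 2%N isT) (proj2 k3 2%N isT) (proj2 k2 2%N isT) A2.
rewrite -sr mkseq_nth => s5 H5 k5.
apply: (runs_post (@push_loop_runs s5 _ (Get 7 (Reg 14)) (Reg 8)
  (q * m) (hash q m (fun i => nth false r i) (bits_of x)) H5 _ _)).
- move=> s6 k6.
  by rewrite /= (proj1 k6 8%N isT) (proj1 k5 8%N isT) (proj1 k4 8%N isT) (proj1 k3 8%N isT).
- move=> s6 i iN k6 h14.
  by rewrite /= h14 (proj2 k6 7%N isT) (proj2 k5 7%N isT) (proj2 k4 7%N isT) H7.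
by move=> s6; rewrite -catA.
Qed.

(** * Relocating a program *)

(** Nothing is known about which registers and arrays the decoder touches. Shifting all of them by
    32 gives it a private memory and protects the data of the receiver. *)
Fixpoint relocate_expr (e : expr) : expr :=
  match e with
  | Cst c => Cst c
  | Reg x => Reg (x + 32)
  | Get A e1 => Get (A + 32) (relocate_expr e1)
  | Add e1 e2 => Add (relocate_expr e1) (relocate_expr e2)
  | Defs.Sub e1 e2 => Sub (relocate_expr e1) (relocate_expr e2)
  end.

Fixpoint relocate (p : prog) : prog :=
  match p with
  | Skip => Skip
  | Assign x e => Assign (x + 32) (relocate_expr e)
  | Store A e1 e2 => Store (A + 32) (relocate_expr e1) (relocate_expr e2)
  | Seq p q => Seq (relocate p) (relocate q)
  | If e p q => If (relocate_expr e) (relocate p) (relocate q)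
  | While e p => While (relocate_expr e) (relocate p)
  end.

Definition upper (s : state) : state :=
  State (fun x => reg s (x + 32)%N) (fun A => arr s (A + 32)%N).

Definition overlay (lo hi : state) : state :=
  State (fun x => if (x < 32)%N then reg lo x else reg hi (x - 32)%N)
        (fun A => if (A < 32)%N then arr lo A else arr hi (A - 32)%N).

Lemma overlay_upper s : overlay s (upper s) = s.
Proof.
case: s => r a; rewrite /overlay /=; congr State; apply/funext => x;
  by case: ltnP => // /subnK ->.
Qed.

Lemma upper_overlay lo hi : upper (overlay lo hi) = hi.
Proof.
case: hi => r a; rewrite /upper /=; congr State; apply/funext => x;
  by rewrite ltnNge leq_addl /= addnK.
Qed.

Lemma eval_overlay lo hi e : eval (overlay lo hi) (relocate_expr e) = eval hi e.
Proof.
elim: e => //= [x|A e ->|e -> e' ->|e -> e' ->] //;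
  by rewrite ltnNge leq_addl /= addnK.
Qed.

Lemma ecost_relocate e : ecost (relocate_expr e) = ecost e.
Proof. by elim: e => //= [A e ->|e -> e' ->|e -> e' ->]. Qed.

Lemma set_reg_overlay lo hi x v :
  set_reg (x + 32) v (overlay lo hi) = overlay lo (set_reg x v hi).
Proof.
rewrite /set_reg /overlay /=; congr State; apply/funext => y.
case: (ltnP y 32) => [y32|y32]; first by rewrite ltn_eqF //; lia.
by rewrite -{1}(subnK y32) eqn_add2r.
Qed.

Lemma set_cell_overlay lo hi A i v :
  set_cell (A + 32) i v (overlay lo hi) = overlay lo (set_cell A i v hi).
Proof.
rewrite /set_cell /set_arr /overlay /=; congr State; apply/funext => B.
case: (ltnP B 32) => [B32|B32]; first by rewrite ltn_eqF //; lia.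
by rewrite -{1}(subnK B32) eqn_add2r ltnNge leq_addl /= addnK.
Qed.

(** The simulation is step by step with equal costs, so relocation does not change the time of the
    decoder. *)
Lemma exec_relocate p s t s' lo : exec p s t s' ->
  exec (relocate p) (overlay lo s) t (overlay lo s').
Proof.
elim=> {p s t s'} /=.
- by move=> s; constructor.
- move=> x e s; rewrite -set_reg_overlay -(eval_overlay lo) -(ecost_relocate e); constructor.
- move=> A e1 e2 s; rewrite -set_cell_overlay -(eval_overlay lo s e1) -(eval_overlay lo s e2).
  rewrite -(ecost_relocate e1) -(ecost_relocate e2).
  constructor.
- by move=> p q s t1 s1 t2 s2 _ e1 _ e2; apply: ExecSeq e1 e2.
- move=> e p q s t s'; rewrite -(eval_overlay lo) -(ecost_relocate e) => h _ e1.
  exact: ExecIfTrue.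
- move=> e p q s t s'; rewrite -(eval_overlay lo) -(ecost_relocate e) => h _ e1.
  exact: ExecIfFalse.
- move=> e p s; rewrite -(eval_overlay lo) -(ecost_relocate e) => h; exact: ExecWhileStop.
- move=> e p s t1 s1 t2 s2; rewrite -(eval_overlay lo) -(ecost_relocate e) => h _ e1 _ e2.
  exact: ExecWhileLoop e1 e2.
Qed.

Lemma relocate_runs p s t v : exec p (upper s) t v ->
  runs (relocate p) s t (fun s' => [/\ upper s' = v,
    forall x, (x < 32)%N -> reg s' x = reg s x & forall A, (A < 32)%N -> arr s' A = arr s A]).
Proof.
move=> /(exec_relocate s); rewrite overlay_upper => e; exists t, (overlay s v); split=> //.
split; first exact: upper_overlay.
  by move=> x /= ->.
by move=> x /= ->.
Qed.

Lemma keeps_upper p s s' : keeps p s s' ->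
  all (fun x => x < 32)%N (wregs p ++ warrs p) -> upper s' = upper s.
Proof.
move=> [kr ka]; rewrite all_cat => /andP[/allP wr /allP wa].
rewrite /upper; congr State; apply/funext => x.
  by apply: kr; apply/negP => /wr; rewrite ltnNge leq_addl.
by apply: ka; apply/negP => /wa; rewrite ltnNge leq_addl.
Qed.

Lemma upper_set_reg x v s : (x < 32)%N -> upper (set_reg x v s) = upper s.
Proof.
move=> x32; rewrite /upper /set_reg /=; congr State; apply/funext => y.
by rewrite gtn_eqF //; lia.
Qed.

Lemma upper_set_cell A i v s : upper (set_cell (A + 32) i v s) = set_cell A i v (upper s).
Proof.
rewrite /upper /set_cell /set_arr /=; congr State; apply/funext => B.
by rewrite eqn_add2r.
Qed.

Lemma set_cell_arr A i v f s :
  set_cell A i v (set_arr A f s) = set_arr A (fun j => if j == i then v else f j) s.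
Proof.
rewrite /set_cell /set_arr /=; congr State; apply/funext => B.
by rewrite eqxx; case: eqP.
Qed.

(** * The receiver *)

Definition setup : prog :=
  Seq row_base
 (Seq (Assign 32 (Reg 0))
 (Seq (Assign 33 (Reg 1))
 (Seq (Assign 34 (Reg 2))
 (Seq (Assign 35 (Reg 3))
      (For 14 (Reg 20) (Store 32 (Reg 14) (Get 0 (Reg 14)))))))).

(** The conclusion is an equality of states because the decoder is specified from one exact state.
    Copying [k * n] cells reaches it, the others being 0. The copy must precede [analyse], which
    overwrites array 0. *)
Lemma setup_runs k n (G : 'M['F_2]_(k, n)) radius L acc (y : 'rV['F_2]_n) r m :
  runs setup (bob_input (code_state radius L G) acc y r m)
    (k * 12 + k * n * 12 + 22)%N (fun s' =>
    reg s' 20%N = (k * n)%N /\ upper s' = code_state radius L G).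
Proof.
set s := bob_input _ _ _ _ _.
apply: (@runs_leT _ _ ((k * 12 + 8) + (2 + (2 + (2 + (2 + (k * n * (1 + 4 + 7) + (1 + 5)))))))%N);
  last by lia.
apply: (runs_seq_call (@row_base_runs s k n erefl erefl)) => s1 g20 k1.
do 4 (apply: runs_seq; apply: runs_assign => /=).
set s2 := set_reg 35 _ _.
have u2 : upper s2 = set_arr arr_code (fun=> 0%N) (code_state radius L G).
  have us : upper s = zero_state by congr State; apply/funext => x; rewrite addnC.
  have u1 : upper s1 = zero_state by rewrite (keeps_upper k1 isT).
  rewrite /upper /code_state /set_arr /set_reg /=; congr State.
    apply/funext => x.
    do 4 (destruct x as [|x]; first by
      rewrite /= ?(proj1 k1 0%N isT) ?(proj1 k1 1%N isT) ?(proj1 k1 2%N isT) ?(proj1 k1 3%N isT)).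
    by apply: etrans (congr1 (fun z => reg z x.+4) u1); rewrite /= addnC.
  apply/funext => A; have := congr1 (fun z => arr z A) u1; rewrite /= => ->.
  by case: A.
pose J i s' := [/\ reg s' 20%N = (k * n)%N,
  upper s' = set_arr arr_code
    (fun p => if (p < i)%N then cells G p else 0%N) (code_state radius L G)
  & arr s' 0%N = cells G].
apply: (@runs_post _ _ _ (fun s' => J (k * n)%N s' /\ reg s' 14%N = (k * n)%N)).
  apply: (@runs_for 14 (Reg 20) _ _ _ (k * n)%N J) => // [s3 k3||i s3 ikn k3 h14 [J1 J2 J3]].
  - by rewrite /= (proj1 k3 20%N isT).
  - split=> //; last by rewrite /= (proj2 k1 0%N isT).
    by rewrite upper_set_reg.
  - apply: runs_store; split=> //=.
    rewrite upper_set_reg // (upper_set_cell 0) J2 set_cell_arr h14 J3.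
    congr set_arr; apply/funext => j; rewrite ltnS.
    by case: ltngtP => //= ->.
move=> s3 [[J1 J2 _] _]; split=> //; rewrite J2 /set_arr /code_state /=; congr State.
apply/funext => B; case: eqP => // _; apply/funext => p.
by case: ltnP => // h; rewrite cells_outside.
Qed.

Definition unpack_prog : prog :=
  Seq (Assign 18 (Cst 0))
    (For 14 (Reg 0) (If (Get 6 (Reg 14)) Skip
       (Seq (Store 8 (Reg 14) (Get 3 (Reg 18))) (Assign 18 (Add (Reg 18) (Cst 1)))))).

Lemma unpack_runs s n B (m : seq bool) :
  reg s 0%N = n -> (forall i, arr s 3%N i = nth false m i) ->
  (forall l, arr s 6%N l = ~~ is_free n B l) -> (forall l, arr s 8%N l = 0%N) ->
  runs unpack_prog s (n * 20 + 8)%N (fun s' =>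
    reg s' 18%N = count (is_free n B) (iota 0 n) /\ forall l, arr s' 8%N l = unpack n B m l).
Proof.
move=> h0 h3 h6 h8.
apply: (@runs_leT _ _ (2 + (n * (1 + (2.+1 + (1 + (4 + 4))) + 7) + (1 + 5)))%N); last by lia.
apply: runs_seq; apply: runs_assign => /=.
pose J i s' := reg s' 18%N = count (is_free n B) (iota 0 i) /\
  forall l, arr s' 8%N l = if (l < i)%N then unpack n B m l : nat else 0%N.
apply: (@runs_post _ _ _ (fun s' => J n s' /\ reg s' 14%N = n)).
  apply: (@runs_for 14 (Reg 0) _ _ _ n J) => // [s1 k1|i s1 iN k1 h14 [J1 J2]].
  - by rewrite /= (proj1 k1 0%N isT).
  - have Ji : count (is_free n B) (iota 0 i.+1)
        = (count (is_free n B) (iota 0 i) + is_free n B i)%N.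
      by rewrite -addn1 iotaD count_cat /= addn0.
    apply: runs_if => /=; rewrite (proj2 k1 6%N isT) h14 /= h6.
    + rewrite eqb0 negbK => fi; apply: runs_skip; split.
        by rewrite Ji (negbTE fi) addn0; exact: J1.
      move=> l; rewrite J2 ltnS; case: ltngtP => // ->.
      by rewrite /unpack (negbTE fi) andbF.
    + move=> /eqP; rewrite eqb0 negbK => fi.
      apply: runs_seq; apply: runs_store; apply: runs_assign; split.
        by rewrite Ji /= J1 fi addn1.
      move=> l; rewrite /= h14 J1 (proj2 k1 3%N isT) J2 ltnS /= h3.
      by case: ltngtP => // ->; rewrite /unpack iN fi.
move=> s' [[J1 J2] _]; split=> // l; rewrite J2; case: ltnP => // nl.
by rewrite /unpack ltnNge nl.
Qed.

(** The cut at [c] makes this stream equal to the whole of array 2, which is 0 beyond the copied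
    bits; the receiver has no coins, so it starts at 0. *)
Definition seed_of (off c : nat) (m : seq bool) : bits :=
  fun t => (t < c)%N && nth false m (off + t).

Definition seed_prog : prog :=
  For 14 (Reg 9) (Seq (Store 2 (Reg 14) (Get 3 (Reg 18))) (Assign 18 (Add (Reg 18) (Cst 1)))).

Lemma seed_runs s c off (m : seq bool) :
  reg s 9%N = c -> reg s 18%N = off -> (forall i, arr s 3%N i = nth false m i) ->
  (forall l, arr s 2%N l = 0%N) ->
  runs seed_prog s (c * 16 + 6)%N (fun s' =>
    reg s' 18%N = (off + c)%N /\ forall l, arr s' 2%N l = seed_of off c m l).
Proof.
move=> h9 h18 h3 h2.
apply: (@runs_leT _ _ (c * (1 + (4 + 4) + 7) + (1 + 5))%N); last by lia.
pose J i s' := reg s' 18%N = (off + i)%N /\ forall l, arr s' 2%N l = seed_of off i m l.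
apply: (@runs_post _ _ _ (fun s' => J c s' /\ reg s' 14%N = c)); last by move=> ? [].
apply: (@runs_for 14 (Reg 9) _ _ _ c J) => // [s1 k1||i s1 iN k1 h14 [J1 J2]].
- by rewrite /= (proj1 k1 9%N isT).
- by split=> //=; rewrite addn0.
- apply: runs_seq; apply: runs_store; apply: runs_assign; split=> /=.
    by rewrite J1; lia.
  move=> l; rewrite h14 J1 (proj2 k1 3%N isT) J2 /seed_of ltnS /= h3.
  by case: ltngtP => // ->.
Qed.

(** Array 33 is the relocated input array [arr_word] of the decoder. *)
Definition correct_word : prog :=
  For 14 (Reg 0) (Store 33 (Reg 14) (Xor (Get 1 (Reg 14)) (Get 8 (Reg 14)))).

Lemma correct_word_runs s n s0 (y e : bits) :
  reg s 0%N = n -> upper s = s0 -> arr s0 1%N = (fun=> 0%N) ->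
  (forall i, arr s 1%N i = y i) -> (forall i, arr s 8%N i = e i) ->
  supported n y -> supported n e ->
  runs correct_word s (n * 22 + 6)%N (fun s' =>
    upper s' = set_arr arr_word (fun i => addbits y e i : nat) s0).
Proof.
move=> h0 hs0 s01 h1 h8 sy se.
apply: (@runs_leT _ _ (n * (1 + 13 + 7) + (1 + 5))%N); last by lia.
pose J i s' := upper s' = set_arr arr_word
  (fun l => if (l < i)%N then addbits y e l : nat else 0%N) s0.
apply: (@runs_post _ _ _ (fun s' => J n s' /\ reg s' 14%N = n)).
  apply: (@runs_for 14 (Reg 0) _ _ _ n J) => // [s1 k1||i s1 iN k1 h14 J1].
  - by rewrite /= (proj1 k1 0%N isT).
  - rewrite /J upper_set_reg // hs0; case: (s0) s01 => r a /= s01.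
    rewrite /set_arr /=; congr State; apply/funext => B.
    by case: eqP => // ->.
  - apply: runs_store; rewrite /J upper_set_reg // (upper_set_cell 1) J1 set_cell_arr /= h14.
    rewrite (proj2 k1 1%N isT) (proj2 k1 8%N isT) /= h1 h8 xor_nat.
    congr set_arr; apply/funext => j; rewrite ltnS.
    by case: ltngtP => //= ->.
move=> s' [-> _]; congr set_arr; apply/funext => l; case: ltnP => // nl.
by rewrite /addbits sy ?se.
Qed.

(** Array 36 is the relocated output of the decoder. The candidate is put in array 1 because
    [hash_prog] reads its argument there; [y] has been consumed by then. *)
Definition try_candidate : prog :=
  Seq (For 14 (Reg 0) (Store 1 (Reg 14)
         (Xor (Get 36 (Add (Reg 16) (Reg 14))) (Get 8 (Reg 14)))))
 (Seq (Assign 16 (Add (Reg 16) (Reg 0)))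
 (Seq hash_prog
 (Seq (Assign 19 (Cst 1))
 (Seq (For 14 (Reg 8)
        (If (Xor (Get 7 (Reg 14)) (Get 3 (Add (Reg 18) (Reg 14))))
           (Assign 19 (Cst 0)) Skip))
      (If (Reg 19) (For 14 (Reg 0) (Store 4 (Reg 14) (Get 1 (Reg 14)))) Skip))))).

Definition try_time n q m : nat := (n * 38 + hash_time q m + q * m * 27 + 28)%N.

Definition accepts q m (s : bits) (off : nat) (msg : seq bool) (u : bits) : bool :=
  all (fun t => hash q m s u t == nth false msg (off + t)) (iota 0 (q * m)).

(** The last block may extend past [n], so array 1 has to be 0 there, and this is carried from one
    candidate to the next. *)
Lemma try_runs st n q m i (s z e w : bits) off msg :
  reg st 0%N = n -> reg st 6%N = m -> reg st 7%N = q -> reg st 8%N = (q * m)%N ->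
  reg st 18%N = off -> reg st 16%N = (i * n)%N ->
  (forall t, arr st 2%N t = s t) -> (forall t, arr st 3%N t = nth false msg t) ->
  (forall t, arr st 8%N t = e t) ->
  (forall j, (j < n)%N -> arr st 36%N (i * n + j)%N = z j) ->
  (forall j, (n <= j)%N -> arr st 1%N j = 0%N) ->
  supported n z -> supported n e ->
  (forall j, (j < n)%N -> arr st 4%N j = w j) ->
  runs try_candidate st (try_time n q m) (fun st' =>
    [/\ reg st' 16%N = (i.+1 * n)%N, forall j, (n <= j)%N -> arr st' 1%N j = 0%N
      & forall j, (j < n)%N -> arr st' 4%N j =
          (if accepts q m s off msg (addbits z e) then addbits z e else w) j]).
Proof.
move=> h0 h6 h7 h8 h18 h16 a2 a3 a8 a36 a1 sz se a4.
apply: (@runs_leT _ _ ((n * (1 + 17 + 7) + (1 + 5)) + (4 + (hash_time q m +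
  (2 + ((q * m * (1 + (15.+1 + (2 + 1)) + 7) + (1 + 5)) +
  (1.+1 + ((n * (1 + 4 + 7) + (1 + 5)) + 1)))))))%N); last by rewrite /try_time; lia.
set u := addbits z e; have su : supported n u by move=> l nl; rewrite /u /addbits sz ?se.
pose J l s' := forall j, arr s' 1%N j = if (j < l)%N then u j : nat else arr st 1%N j.
apply: (@runs_seq_call _ _ _ _ _ (fun s' => J n s' /\ reg s' 14%N = n)).
  apply: (@runs_for 14 (Reg 0) _ _ _ n J) => // [s1 k1|l s1 ln k1 h14 J1].
    by rewrite /= (proj1 k1 0%N isT).
  apply: runs_store => j /=.
  rewrite h14 (proj2 k1 36%N isT) (proj1 k1 16%N isT) (proj2 k1 8%N isT) /= h16 a36 // a8.
  by rewrite xor_nat J1 ltnS; case: ltngtP => // ->.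
move=> s1 [J1 _] k1; apply: runs_seq; apply: runs_assign => /=.
set s2 := set_reg 16 _ s1.
have h1 j : arr s2 1%N j = u j.
  by rewrite /= J1; case: ltnP => // nj; rewrite a1 // su.
apply: (runs_seq_call (@hash_runs s2 s u q m _ _ _ _ h1)).
- by rewrite /= (proj1 k1 6%N isT).
- by rewrite /= (proj1 k1 7%N isT).
- by rewrite /= (proj1 k1 8%N isT).
- by move=> t; rewrite /= (proj2 k1 2%N isT).
move=> s3 H7 k3; apply: runs_seq; apply: runs_assign => /=.
pose K l s' := reg s' 19%N =
  all (fun t => hash q m s u t == nth false msg (off + t)) (iota 0 l).
apply: (@runs_seq_call _ _ _ _ _ (fun s' => K (q * m)%N s' /\ reg s' 14%N = (q * m)%N)).
  apply: (@runs_for 14 (Reg 8) _ _ _ (q * m)%N K) => // [s4 k4|l s4 ln k4 h14 K1].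
    by rewrite /= (proj1 k4 8%N isT) /= (proj1 k3 8%N isT) /= (proj1 k1 8%N isT).
  have Kl : all (fun t => hash q m s u t == nth false msg (off + t)) (iota 0 l.+1)
      = (reg s4 19%N == 1%N) && (hash q m s u l == nth false msg (off + l)).
    by rewrite -addn1 iotaD all_cat /= andbT K1; congr (_ && _); case: all.
  have V : eval s4 (Xor (Get 7 (Reg 14)) (Get 3 (Add (Reg 18) (Reg 14))))
      = hash q m s u l (+) nth false msg (off + l).
    rewrite /= h14 (proj2 k4 7%N isT) (proj2 k4 3%N isT) (proj1 k4 18%N isT) /= H7 //.
    rewrite (proj2 k3 3%N isT) (proj1 k3 18%N isT) /= (proj2 k1 3%N isT) (proj1 k1 18%N isT).
    by rewrite h18 a3 xor_nat.
  apply: runs_if; rewrite V.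
  + rewrite eqb0 negbK => d; apply: runs_assign; rewrite /K Kl /=.
    by move: d; case: hash; case: nth => //=; rewrite andbF.
  + move=> /eqP; rewrite eqb0 => d; apply: runs_skip; rewrite /K Kl /=.
    have -> : hash q m s u l == nth false msg (off + l) by move: d; case: hash; case: nth.
    by rewrite andbT K1; case: all.
move=> s4 [K1 _] k4.
have g16 : reg s4 16%N = (i.+1 * n)%N.
  rewrite (proj1 k4 16%N isT) /= (proj1 k3 16%N isT) /= (proj1 k1 16%N isT) (proj1 k1 0%N isT).
  by rewrite h16 h0 mulSn addnC.
have g1 : arr s4 1%N = fun j => u j : nat.
  by apply/funext => j; rewrite (proj2 k4 1%N isT) /= (proj2 k3 1%N isT) h1.
have g4 : arr s4 4%N = arr st 4%N.
  by rewrite (proj2 k4 4%N isT) /= (proj2 k3 4%N isT) /= (proj2 k1 4%N isT).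
have g0 : reg s4 0%N = n.
  by rewrite (proj1 k4 0%N isT) /= (proj1 k3 0%N isT) /= (proj1 k1 0%N isT).
apply: runs_if => /=; rewrite K1 -/(accepts q m s off msg u).
- rewrite eqb0 negbK => ->.
  pose W l s' := forall j, arr s' 4%N j = if (j < l)%N then u j : nat else arr st 4%N j.
  apply: (@runs_call _ _ _ _ (fun s' => W n s' /\ reg s' 14%N = n) _ _ (leqnn _)).
    apply: (@runs_for 14 (Reg 0) _ _ _ n W) => // [s5 k5||l s5 ln k5 h14 W1].
    + by rewrite /= (proj1 k5 0%N isT).
    + by move=> j; rewrite /= g4.
    + apply: runs_store => j /=; rewrite h14 (proj2 k5 1%N isT) /= g1 W1 ltnS.
      by case: ltngtP => // ->.
  move=> s5 [W1 _] k5; split.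
  + by rewrite (proj1 k5 16%N isT).
  + by move=> j nj; rewrite (proj2 k5 1%N isT) g1 su.
  + by move=> j jn; rewrite W1 jn.
- move=> /eqP; rewrite eqb0 => /negbTE ->; apply: runs_skip; split=> //.
  + by move=> j nj; rewrite g1 su.
  + by move=> j jn; rewrite g4 a4.
Qed.

(** Running [analyse] on [y] provides the parameters and the pivot flags; the syndrome of [y] that
    it also produces is ignored. *)
Definition bob (D : prog) : prog :=
  Seq setup (Seq analyse (Seq unpack_prog (Seq seed_prog (Seq correct_word
    (Seq (relocate D) (Seq (Assign 16 (Cst 0)) (For 22 (Reg 37) try_candidate))))))).

Definition offset k n (G : 'M['F_2]_(k, n)) : nat :=
  count (is_free n (reduced_rows n (matrix_rows G) k)) (iota 0 n).

Definition select k n (G : 'M['F_2]_(k, n)) q m (msg : seq bool) (v w z : 'rV['F_2]_n) :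
    'rV['F_2]_n :=
  if accepts q m (seed_of (offset G) (q * m + m) msg) (offset G + (q * m + m)) msg
       (bits_of (z + v)) then z + v else w.

Definition receive k n (G : 'M['F_2]_(k, n)) q m (dec : 'rV['F_2]_n -> seq 'rV['F_2]_n)
    (y : 'rV['F_2]_n) (msg : seq bool) : 'rV['F_2]_n :=
  let v := vec n (unpack n (reduced_rows n (matrix_rows G) k) msg) in
  foldl (select G q m msg v) 0 (dec (y + v)).

Definition bob_time k n m q : nat :=
  ((k * 12 + k * n * 12 + 22) + analyse_time k n m q + (n * 20 + 8)
   + ((q * m + m) * 16 + 6) + (n * 22 + 6) + 8)%N.

Lemma bob_runs k n (G : 'M['F_2]_(k, n)) radius L acc D dec Tc (y : 'rV['F_2]_n) rB msg :
  let m := hash_width acc L in let q := block_count n m in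
  row_free G -> rB = [::] ->
  (forall y', exists t v, [/\ exec D (decoder_input (code_state radius L G) y') t v,
     outputs_list v (dec y'), (t <= Tc)%N & (size (dec y') <= L)%N]) ->
  runs (bob D) (bob_input (code_state radius L G) acc y rB msg)
    (Tc + L * (try_time n q m + 8) + bob_time k n m q)%N
    (fun s' => outputs_word s' (receive G q m dec y msg)).
Proof.
move=> m q Gf -> hdec; set s := bob_input _ _ _ _ _.
set B := reduced_rows n (matrix_rows G) k; set e := unpack n B msg.
have se : supported n e by move=> l nl; rewrite /e /unpack ltnNge nl.
have [t [v [ex [lv1 lv2] tT szL]]] := hdec (y + vec n e).
set l := dec (y + vec n e) in lv1 lv2 szL.
apply: (@runs_leT _ _ ((k * 12 + k * n * 12 + 22) + (analyse_time k n m q + ((n * 20 + 8)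
   + (((q * m + m) * 16 + 6) + ((n * 22 + 6) + (t + (2 + (size l * (1 + try_time n q m + 7) + (1 + 5)))))))))%N);
  last first.
  have : (size l * (1 + try_time n q m + 7) <= L * (try_time n q m + 8))%N.
    by apply: leq_mul => //; lia.
  by rewrite /bob_time; lia.
apply: (runs_seq_call (@setup_runs k n G radius L acc y [::] msg)) => s1 [g20 u1] k1.
have R i : i \in [:: 0; 1; 3; 4]%N -> reg s1 i = reg s i.
  by move=> ii; rewrite (proj1 k1) //; move: ii; rewrite !inE => /or4P[] /eqP ->.
have A1 : arr s1 1%N = (fun i => bits_of y i : nat).
  by rewrite (proj2 k1 1%N isT) /= cells_row.
apply: (runs_seq_call (@analyse_runs k n G s1 L acc (bits_of y) Gf _ _ _ _ g20 _ _ _ _));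
  rewrite ?R //.
- by rewrite (proj2 k1 0%N isT).
- by move=> j; rewrite A1.
- by move=> j; rewrite (proj2 k1 5%N isT).
- by move=> j; rewrite (proj2 k1 6%N isT).
rewrite -/m -/q -/B => s2 [[g6 g7 g8 g9] [_ H6]] k2.
have u2 := keeps_upper k2 isT.
have A3 i : arr s2 3%N i = nth false msg i by rewrite (proj2 k2 3%N isT) (proj2 k1 3%N isT).
have g0 : reg s2 0%N = n by rewrite (proj1 k2 0%N isT) (proj1 k1 0%N isT).
apply: (runs_seq_call (@unpack_runs s2 n B msg g0 A3 H6 _)).
  by move=> j; rewrite (proj2 k2 8%N isT) (proj2 k1 8%N isT).
rewrite -/e -/(offset G) => s3 [g18 H8] k3; have u3 := keeps_upper k3 isT.
apply: (runs_seq_call (@seed_runs s3 (q * m + m) (offset G) msg _ g18 _ _)).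
- by rewrite (proj1 k3 9%N isT).
- by move=> i; rewrite (proj2 k3 3%N isT) A3.
- by move=> i; rewrite (proj2 k3 2%N isT) (proj2 k2 2%N isT) (proj2 k1 2%N isT); case: i.
move=> s4 [f18 H2] k4; have u4 := keeps_upper k4 isT.
have B1 : arr s4 1%N = (fun i => bits_of y i : nat).
  by rewrite (proj2 k4 1%N isT) (proj2 k3 1%N isT) (proj2 k2 1%N isT).
apply: (runs_seq_call (@correct_word_runs s4 n (code_state radius L G) (bits_of y) e _ _ _ _ _ _ _)).
- by rewrite (proj1 k4 0%N isT) (proj1 k3 0%N isT).
- by rewrite u4 u3 u2.
- by [].
- by move=> i; rewrite B1.
- by move=> i; rewrite (proj2 k4 8%N isT).
- exact: bits_of_supported.
- exact: se.
move=> s5 u5 k5.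
(* The relocated memory is now exactly the input on which the decoder is specified, so its execution
   can be transported. *)
have u5' : upper s5 = decoder_input (code_state radius L G) (y + vec n e).
  by rewrite u5 /decoder_input cells_row bits_ofD vecK.
rewrite -u5' in ex.
apply: runs_seq; apply: (runs_le (relocate_runs ex) (leqnn _)) => s6 [u6 r6 a6].
apply: runs_seq; apply: runs_assign => /=.
set s7 := set_reg 16 _ s6; set V := vec n e in l lv1 lv2 szL *.
(* [W i] is the guess after [i] candidates; it starts at the zero word, which is also the initial
   content of array 4. *)
pose W i := foldl (select G q m msg V) 0 (take i l).
pose J i s' := [/\ reg s' 16%N = (i * n)%N, forall j, (n <= j)%N -> arr s' 1%N j = 0%N
  & forall j, (j < n)%N -> arr s' 4%N j = bits_of (W i) j].
apply: (@runs_post _ _ _ (fun s' => J (size l) s' /\ reg s' 22%N = size l)).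
  apply: (@runs_for 22 (Reg 37) _ _ _ (size l) J) => // [s8 k8||i s8 il k8 h22 [J1 J2 J3]].
  - rewrite /= (proj1 k8 37%N isT) /=.
    by rewrite -lv1 -u6.
  - split=> // j jn.
    + by rewrite /= a6 // (proj2 k5 1%N isT) B1 bits_of_supported.
    + rewrite /W take0 /= a6 // (proj2 k5 4%N isT) (proj2 k4 4%N isT) (proj2 k3 4%N isT).
      rewrite (proj2 k2 4%N isT) (proj2 k1 4%N isT) /=.
      by rewrite (bits_ofE _ (Ordinal jn)) mxE eqxx.
  - have zE : addbits (bits_of (nth 0 l i)) e = bits_of (nth 0 l i + V).
      by rewrite bits_ofD vecK.
    apply: (runs_post (@try_runs s8 n q m i (seed_of (offset G) (q * m + m) msg)
      (bits_of (nth 0 l i)) e (bits_of (W i)) (offset G + (q * m + m)) msg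
      _ _ _ _ _ _ _ _ _ _ _ _ _ _)) => //.
    + rewrite (proj1 k8 0%N isT) /= r6 // (proj1 k5 0%N isT) (proj1 k4 0%N isT) (proj1 k3 0%N isT).
      exact: g0.
    + rewrite (proj1 k8 6%N isT) /= r6 // (proj1 k5 6%N isT) (proj1 k4 6%N isT) (proj1 k3 6%N isT).
      exact: g6.
    + rewrite (proj1 k8 7%N isT) /= r6 // (proj1 k5 7%N isT) (proj1 k4 7%N isT) (proj1 k3 7%N isT).
      exact: g7.
    + rewrite (proj1 k8 8%N isT) /= r6 // (proj1 k5 8%N isT) (proj1 k4 8%N isT) (proj1 k3 8%N isT).
      exact: g8.
    + by rewrite (proj1 k8 18%N isT) /= r6 // (proj1 k5 18%N isT).
    + by move=> p; rewrite (proj2 k8 2%N isT) /= a6 // (proj2 k5 2%N isT).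
    + move=> p; rewrite (proj2 k8 3%N isT) /= a6 // (proj2 k5 3%N isT) (proj2 k4 3%N isT).
      by rewrite (proj2 k3 3%N isT).
    + by move=> p; rewrite (proj2 k8 8%N isT) /= a6 // (proj2 k5 8%N isT) (proj2 k4 8%N isT).
    + move=> j jn; rewrite (proj2 k8 36%N isT) /= -[arr s6 36%N]/(arr (upper s6) 4%N) u6.
      by rewrite (lv2 i (Ordinal jn)) // F2_nat (bits_ofE _ (Ordinal jn)).
    + exact: bits_of_supported.
    move=> s9 [f16 f1 f4]; split=> //.
    move=> j jn; rewrite /= f4 // /W (take_nth 0) // foldl_rcons zE /select.
    by case: ifP.
move=> s8 [[_ _ J3] _] j; rewrite /arr_out J3 //.
by rewrite /W take_size bits_ofE -F2_nat.
Qed.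

(** * The error probability *)

Lemma hammingC n (x y : 'rV['F_2]_n) : hamming x y = hamming y x.
Proof. by rewrite /hamming; congr #|pred_of_set _|; apply/setP => i; rewrite !inE eq_sym. Qed.

Lemma hammingDr n (x y v : 'rV['F_2]_n) : hamming (x + v) (y + v) = hamming x y.
Proof.
rewrite /hamming; congr #|pred_of_set _|; apply/setP => i.
by rewrite !inE !mxE (inj_eq (addIr _)).
Qed.

Lemma generator_dim k n (G : 'M['F_2]_(k, n)) : row_free G -> (k <= n)%N.
Proof. by move=> /eqP <-; exact: rank_leq_col. Qed.

Lemma card_generated k n (G : 'M['F_2]_(k, n)) C : generator_matrix G C -> #|C| = (2 ^ k)%N.
Proof.
move=> [Gf ->].
have inj : injective (fun u : 'rV['F_2]_k => u *m G) by exact: row_free_inj.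
have -> : [set x | (x <= G)%MS]%SET = [set u *m G | u : 'rV['F_2]_k]%SET.
  apply/setP => x; rewrite inE; apply/idP/imsetP => [/submxP[u ->]|[u _ ->]].
    by exists u.
  exact: submxMl.
by rewrite card_imset // card_mx mul1n card_Fp.
Qed.

Lemma size_message k n (G : 'M['F_2]_(k, n)) q m x r : row_free G -> size r = (q * m + m)%N ->
  size (message G q m x r) = (n - k + ((q * m + m) + q * m))%N.
Proof.
move=> Gf sr; rewrite !size_cat size_mkseq sr size_pack ?size_reduced_rows //.
exact: reduced_rows_echelon.
Qed.

Lemma nth_cat_add (T : Type) (x0 : T) s1 s2 i :
  nth x0 (s1 ++ s2) (size s1 + i) = nth x0 s2 i.
Proof. by rewrite nth_cat ltnNge leq_addr /= addKn. Qed.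

Lemma offsetE k n (G : 'M['F_2]_(k, n)) x : row_free G ->
  offset G = size (pack n (reduced_rows n (matrix_rows G) k) x).
Proof. by move=> Gf; rewrite /pack size_map size_filter. Qed.

Lemma syndrome_supported k n (G : 'M['F_2]_(k, n)) x : supported n x ->
  supported n (syndrome G x).
Proof.
move=> sx; rewrite /syndrome -(reduced_last n k (matrix_rows G) x).
apply: reduced_supported => i ik.
rewrite /with_row; case: eqP => // _; rewrite /matrix_rows; case: insubP => // j _ _.
exact: bits_of_supported.
Qed.

Section Decoding.
Variables (k n : nat) (G : 'M['F_2]_(k, n)) (q m : nat) (x : 'rV['F_2]_n) (r : seq bool).
Hypotheses (Gf : row_free G) (sr : size r = (q * m + m)%N).

Let B := reduced_rows n (matrix_rows G) k.
Let e := syndrome G (bits_of x).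
Let msg := message G q m x r.

Lemma unpack_message : unpack n B msg = e.
Proof.
apply: unpack_pack; first exact/syndrome_supported/bits_of_supported.
by move=> u uB; apply: clear_lead uB; apply: reduced_rows_echelon.
Qed.

(** On a genuine message the test of the receiver is collision with [x] under the coins of the
    sender, so only the coins remain random. *)
Lemma accepts_message u :
  accepts q m (seed_of (offset G) (q * m + m) msg) (offset G + (q * m + m)) msg u
  = collide q m (fun i => nth false r i) u (bits_of x).
Proof.
have seedE : seed_of (offset G) (q * m + m) msg = fun i => nth false r i.
  apply/funext => i; rewrite /seed_of /msg /message (offsetE e Gf) -/B -/e nth_cat_add nth_cat sr.
  by case: ltnP => //= h; rewrite nth_default ?sr.
rewrite /accepts seedE /collide; apply: eq_in_all => t; rewrite mem_iota add0n => /andP[_ tq].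
congr (_ == _); rewrite /msg /message (offsetE e Gf) -/B -/e -addnA nth_cat_add.
by rewrite -sr nth_cat_add nth_mkseq.
Qed.

Lemma receive_message dec y : x + vec n e \in dec (y + vec n e) ->
  ~~ has (fun z => collide q m (fun i => nth false r i) z (bits_of x))
      [seq bits_of (z + vec n e) | z <- dec (y + vec n e) & z + vec n e != x] ->
  receive G q m dec y msg = x.
Proof.
rewrite /receive unpack_message; set v := vec n e; set l := dec _ => xl nocoll.
have selE w z : select G q m msg v w z =
    if collide q m (fun i => nth false r i) (bits_of (z + v)) (bits_of x) then z + v else w.
  by rewrite /select accepts_message.
have bad z : z \in l -> collide q m (fun i => nth false r i) (bits_of (z + v)) (bits_of x) ->
    z + v = x.
  move=> zl cz; apply/eqP; apply: contraNT nocoll => zx; apply/hasP.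
  exists (bits_of (z + v)) => //; apply/mapP; exists z => //.
  by rewrite mem_filter zx.
(* Either [x] is already the current guess, or its candidate is still ahead; it always passes the
   test, and no wrong word can replace it. *)
have good w : w = x \/ x + v \in l -> foldl (select G q m msg v) w l = x.
  elim: {xl nocoll} l bad w => [|z l IH] bad w /=; first by case.
  move=> h; apply: IH; first by move=> z' z'l; apply: bad; rewrite inE z'l orbT.
  rewrite selE; case: ifP => [cz|cz].
    by left; apply: bad; rewrite ?inE ?eqxx.
  case: h => [->|]; [by left | rewrite inE => /predU1P[zx|]; last by right].
  move: cz; rewrite -zx -addrA rV2_addxx addr0 => /negP[].
  by apply/allP => t _.
by apply: good; right.
Qed.

End Decoding.

Section Error.
Variables (R : realType) (alpha : R) (k n : nat) (G : 'M['F_2]_(k, n)) (C : {set 'rV['F_2]_n}).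
Variables (L q m : nat) (dec : 'rV['F_2]_n -> seq 'rV['F_2]_n).
Hypotheses (hG : generator_matrix G C) (hlist : list_decodable alpha L C).
Hypotheses (decu : forall y, uniq (dec y)) (decE : forall y, dec y =i neighbours alpha C y).

Definition sync_protocol : protocol n :=
  @Protocol n (q * m + m) 0 (fun x r => message G q m x r)
    (fun y _ msg => receive G q m dec y msg).

Lemma size_dec y : (size (dec y) <= L)%N.
Proof.
rewrite -(card_uniqP (decu y)); apply: leq_trans (hlist y).
by apply: subset_leq_card; apply/fintype.subsetP => z; rewrite decE.
Qed.

(** In characteristic 2, adding the syndrome to [x] leaves a combination of rows of [G], and
    translating both words preserves their distance. *)
Lemma syndrome_in_dec x y : admissible alpha x y ->
  x + vec n (syndrome G (bits_of x)) \in dec (y + vec n (syndrome G (bits_of x))).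
Proof.
move=> xy; set v := vec n _; rewrite decE inE hammingDr hammingC; apply/andP; split; last exact: xy.
have [c] := syndrome_comb G (bits_of x); rewrite -/(syndrome G (bits_of x)) -/v bits_ofK => ->.
case: hG => _ ->; rewrite inE addrA rV2_addxx add0r; exact: submxMl.
Qed.

Lemma error_bound x y : (0 < m)%N -> (n <= q * q * m)%N -> admissible alpha x y ->
  error_probability R sync_protocol x y <= L%:R / 2 ^+ m.
Proof.
move=> m0 nq xy; case: (hG) => Gf _.
rewrite /error_probability /=.
set E := [set _ | _]%SET; set v := vec n (syndrome G (bits_of x)).
pose zs := [seq bits_of (z + v) | z <- dec (y + v) & z + v != x].
pose K := [set r : (q * m + m).-tuple bool |
       has (fun z => collide q m (fun i => nth false r i) z (bits_of x)) zs]%SET.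
have cK : (#|K| <= L * 2 ^ (q * m))%N.
  apply: leq_trans (card_has_collide m0 nq (@bits_of_supported _ x) _) _.
    move=> z /(@List.in_map_iff _ _ _ _ _) [w [<-]] wi; split; first exact: bits_of_supported.
    move: (In_mem wi); rewrite mem_filter => /andP[wx _] /(congr1 (vec n)); rewrite !bits_ofK => /eqP.
    by rewrite (negbTE wx).
  rewrite leq_mul2r; apply/orP; right; rewrite size_map.
  by apply: leq_trans (size_dec (y + v)); rewrite size_filter count_size.
have cE : (#|E| <= L * 2 ^ (q * m))%N.
  apply: leq_trans cK; rewrite -[X in (_ <= X)%N]muln1.
  rewrite -[X in (_ <= _ * X)%N](_ : #|{: 0.-tuple bool}| = 1)%N; last first.
    by rewrite card_tuple expn0.
  rewrite -cardsT -cardsX; apply: subset_leq_card; apply/fintype.subsetP => -[r1 r2].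
  rewrite !inE /= andbT; apply: contraR => nc; apply/eqP.
  by apply: receive_message; rewrite ?size_tuple //; exact: syndrome_in_dec.
rewrite card_prod !card_tuple card_bool expn0 muln1 ler_pdivrMr ?ltr0n ?expn_gt0 //.
rewrite mulrAC ler_pdivlMr ?exprn_gt0 // -!natrX -!natrM ler_nat.
by rewrite expnD mulnA leq_mul2r cE orbT.
Qed.

(** All messages have the same length. The pair [(0, 0)], admissible as [alpha] is nonnegative,
    ensures that the maximum attains it. *)
Lemma communication_sync : 0 <= alpha ->
  communication alpha sync_protocol = (n - k + ((q * m + m) + q * m))%N.
Proof.
move=> a0; case: (hG) => Gf _; rewrite /communication /=.
have sz x (r : (q * m + m).-tuple bool) :
    size (message G q m x r) = (n - k + ((q * m + m) + q * m))%N.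
  by apply: size_message => //; rewrite size_tuple.
apply/eqP; rewrite eqn_leq; apply/andP; split.
  by apply/bigmax_leqP => z _; apply/bigmax_leqP => r _; rewrite sz.
have adm : admissible alpha (0 : 'rV['F_2]_n) 0.
  rewrite /admissible /hamming (_ : [set i | _]%SET = finset.set0) ?cards0 ?mulr_ge0 //.
  by apply/setP => i; rewrite !inE eqxx.
apply: leq_trans (leq_bigmax_cond (0, 0) adm) => /=.
have -> : (n - k + ((q * m + m) + q * m))%N =
    size (message G q m 0 (nseq_tuple (q * m + m) false)) by rewrite sz.
exact: leq_bigmax.
Qed.

End Error.

(** * Landau relations as explicit inequalities *)

Lemma little_oP (R : realType) (N : set nat) (f g : nat -> R) :
  little_o N f g <->
  forall e : R, 0 < e -> exists m : nat, forall n, (m <= n)%N -> N n -> `|f n| <= e * `|g n|.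
Proof.
split.
- rewrite /little_o => /eqoP H e e0; have := H _ e0.
  by rewrite near_withinE => -[m _ Hm]; exists m => n mn Nn; exact: Hm.
- move=> H; apply/eqoP => e e0; have [m Hm] := H e e0.
  by rewrite near_withinE; exists m => //= n /= mn Nn; exact: Hm.
Qed.

Lemma big_OP (R : realType) (N : set nat) (f g : nat -> R) :
  big_O N f g <->
  exists (k : R) (m : nat), forall n, (m <= n)%N -> N n -> `|f n| <= k * `|g n|.
Proof.
split.
- rewrite /big_O => /eqO_exP [k k0].
  by rewrite near_withinE => -[m _ Hm]; exists k, m => n mn Nn; exact: Hm.
- move=> [k [m Hm]]; apply/eqO_exP; exists (Num.max 1 k).
    by rewrite lt_max ltr01.
  rewrite near_withinE; exists m => //= n /= mn Nn; apply: le_trans (Hm _ mn Nn) _.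
  by rewrite ler_wpM2r // le_max lexx orbT.
Qed.

(** * Growth of the parameters *)

(** The threshold settles [u <= 4 * c + 2] directly. For larger [u], with [w] half of [u - 1], one
    has [c * u <= 2 * c * (w + 1) <= (w + 1) ^ 2 <= 2 ^ (u - 1) < n]. *)
Lemma up_log_small c n : (4 * c * c + 6 * c + 1 <= n)%N -> (c * up_log 2 n <= n)%N.
Proof.
move=> cn; have n1 : (1 < n)%N \/ c = 0%N by case: c cn => [|c]; [right | left; lia].
case: n1 => [n1|->]; last by [].
have := up_log_gtn (p := 2) isT n1; set u := up_log 2 n => un.
case: (leqP u (4 * c + 2)) => [uc|cu]; first by nia.
pose w := (u.-1 %/ 2)%N.
have w2 : (2 ^ w * 2 ^ w <= 2 ^ u.-1)%N.
  rewrite -expnD leq_exp2l //; rewrite /w; lia.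
have ww : (w.+1 <= 2 ^ w)%N by exact: ltn_expl.
have uw : (u <= 2 * w.+1)%N by rewrite /w; lia.
have cw : (2 * c <= w.+1)%N by lia.
nia.
Qed.

(** If [u > 0] is the logarithm, then [2 ^ (u - 1)] is below [a + 1], hence below twice [2] to the
    power [|g|]. The absolute value covers [a < 1]. *)
Lemma up_log_ceil (R : realType) (a g : R) : 0 < a -> a = 2 `^ g ->
  (up_log 2 `|Num.ceil a|%N)%:R <= `|g| + 2.
Proof.
move=> a0 ag; set c := `|Num.ceil a|%N.
have [c1|c1] := leqP c 1.
  have /eqP -> : up_log 2 c == 0%N by rewrite up_log_eq0 c1 orbT.
  by rewrite addr_ge0.
have := up_log_gtn (p := 2) isT c1; set u := up_log 2 c => uc.
have ca : c%:R < a + 1.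
  have -> : c%:R = (Num.ceil a)%:~R :> R.
    by rewrite /c natr_absz ger0_norm // ceil_ge0; apply: lt_trans a0; rewrite oppr_lt0.
  by have := ceilB1_lt a; rewrite intrD; lra.
have mono (x y : R) : x <= y -> 2 `^ x <= 2 `^ y.
  by apply: ler_powR; rewrite ler1n.
have u0 : (0 < u)%N by rewrite /u up_log_gt0 c1.
have ug : (2 : R) `^ (u.-1)%:R < 2 `^ (`|g| + 1).
  rewrite powR_mulrn // powRD; last by rewrite pnatr_eq0 implybT.
  rewrite powRr1 //.
  have ag1 : a <= 2 `^ `|g| by rewrite ag; apply: mono; exact: ler_norm.
  have g1 : 1 <= (2 : R) `^ `|g| by have := mono 0 _ (normr_ge0 g); rewrite powRr0.
  have : (2 ^ u.-1)%:R < c%:R :> R by rewrite ltr_nat.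
  rewrite natrX; lra.
rewrite leNgt; apply/negP => gu; move: ug; apply/negP; rewrite -leNgt.
apply: mono.
by have e1 : u%:R = u.-1%:R + 1 :> R; [rewrite natr1 prednK | lra].
Qed.

Lemma hash_width_small (R : realType) (N : set nat) (L : nat -> nat) (a g : nat -> R) :
  (exists d : nat, big_O N (fun n => (L n)%:R : R) (fun n => n%:R ^+ d)) ->
  (forall n, N n -> 0 < a n) -> little_o N g (fun n => n%:R) ->
  (forall n, N n -> a n = 2 `^ g n) ->
  little_o N (fun n => (hash_width `|Num.ceil (a n)|%N (L n))%:R : R) (fun n => n%:R).
Proof.
move=> [d /big_OP [K [m1 HL]]] a0 /little_oP og ag; apply/little_oP => e e0.
have e3 : 0 < e / 3 by rewrite divr_gt0.
have [m2 Hg] := og _ e3.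
(* Each third of [e] absorbs one part of the width: [|g|], [d] times the logarithm of [n], and the
   constant [D]. The 3 in [D] is the 2 of [up_log_ceil] plus the successor in [hash_width]. *)
pose K' := Num.bound `|K|; pose D := (3 + up_log 2 K')%N.
pose c := Num.bound (d%:R / (e / 3)).
pose m3 := Num.bound (D%:R / (e / 3)).
exists (maxn (maxn m1 m2) (maxn m3 (4 * c * c + 6 * c + 1))) => n.
rewrite !geq_max => /andP[/andP[nm1 nm2] /andP[nm3 nc]] Nn.
rewrite !ger0_norm //.
have h1 := up_log_ceil (a0 n Nn) (ag n Nn).
have h2 : `|g n| <= e / 3 * n%:R by have := Hg n nm2 Nn; rewrite [`|n%:R|]ger0_norm.
have h3 : (up_log 2 (L n) <= up_log 2 K' + d * up_log 2 n)%N.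
  apply: up_log_min => //; rewrite expnD mulnC [(d * _)%N]mulnC expnM.
  have LK : (L n <= K' * n ^ d)%N.
    rewrite -(ler_nat R) natrM natrX.
    have := HL n nm1 Nn; rewrite !ger0_norm ?exprn_ge0 // => /le_trans; apply.
    apply: ler_wpM2r; first exact: exprn_ge0.
    by apply: le_trans (ler_norm K) _; apply: ltW; apply: archi_boundP.
  apply: leq_trans LK _; rewrite mulnC; apply: leq_mul; last exact: up_logP.
  by case: (d) => // d'; rewrite leq_exp2r //; exact: up_logP.
have h4 : d%:R * (up_log 2 n)%:R <= e / 3 * n%:R :> R.
  have hc : d%:R <= e / 3 * c%:R :> R.
    rewrite mulrC -ler_pdivrMr //; apply: ltW; apply: archi_boundP.
    by rewrite divr_ge0 // ltW.
  apply: (@le_trans _ _ (e / 3 * c%:R * (up_log 2 n)%:R)); first exact: ler_wpM2r.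
  rewrite -mulrA -natrM; apply: ler_wpM2l; first exact: ltW.
  by rewrite ler_nat; exact: up_log_small.
have h5 : D%:R <= e / 3 * n%:R :> R.
  rewrite mulrC -ler_pdivrMr //.
  apply: (@le_trans _ _ m3%:R); last by rewrite ler_nat.
  by apply: ltW; apply: archi_boundP; rewrite divr_ge0 // ltW.
have h6 : (up_log 2 (L n))%:R <= (up_log 2 K')%:R + d%:R * (up_log 2 n)%:R :> R.
  by rewrite -natrM -natrD ler_nat.
rewrite /hash_width -addn1 !natrD; rewrite /D natrD in h5; lra.
Qed.

(** By minimality [q - 1] blocks are too few, so the square of [(q - 1) * m] is at most [n * m],
    hence at most the square of [e * n]; the extra [m] pays for rounding up. *)
Lemma block_length_small (R : realType) (e : R) n m :
  0 <= e -> (0 < m)%N -> m%:R <= e ^+ 2 * n%:R -> 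
  (block_count n m * m)%:R <= e * n%:R + m%:R.
Proof.
move=> e0 m0 me; case E: (block_count n m) => [|q].
  by rewrite mul0n addr_ge0 // mulr_ge0.
have : (q * q * m < n)%N by apply: block_count_min; rewrite E.
move=> qn; rewrite mulSn natrD addrC lerD2r.
rewrite -ler_sqr ?nnegrE ?mulr_ge0 //.
have h : ((q * m)%:R ^+ 2 <= n%:R * m%:R :> R).
  by rewrite -natrX -natrM ler_nat; nia.
apply: le_trans h _; rewrite exprMn [n%:R ^+ 2]expr2 mulrA mulrC; exact: ler_wpM2r.
Qed.

(** * Explicit running times, with generous constants *)

Lemma try_time_bound n q m : (0 < n)%N -> (q <= n)%N -> (m <= n)%N -> (q * m <= 2 * n)%N ->
  (try_time n q m + 8 <= 400 * n ^ 2)%N.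
Proof.
move=> n0 qn mn; rewrite /try_time /hash_time => b; rewrite -[(n ^ 2)%N]/(n * n)%N.
have -> : (q * (m * (q * m * 28 + 23) + 18) = q * m * (q * m * 28 + 23) + q * 18)%N by lia.
move: (q * m)%N b => p b.
have pp : (p * p <= 4 * (n * n))%N by nia.
have nn : (n <= n * n)%N by nia.
nia.
Qed.

Lemma main_time_bound k n q m : (0 < n)%N -> (k <= n)%N -> (q <= n)%N -> (m <= n)%N ->
  (q * m <= 2 * n)%N -> (alice_time k n m q + bob_time k n m q <= 4000 * n ^ 3)%N.
Proof.
move=> n0 kn qn mn b; have := try_time_bound n0 qn mn b.
rewrite /try_time /alice_time /bob_time /analyse_time.
rewrite -[(n ^ 3)%N]/(n * (n * n))%N -[(n ^ 2)%N]/(n * n)%N.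
move: (hash_time q m) (q * m)%N b => h p b.
have kk : (k.+1 * (k.+1 * (n * 60 + 60)) <= 480 * (n * (n * n)))%N.
  have k1 : (k.+1 <= 2 * n)%N by lia.
  have k2 : (n * 60 + 60 <= 120 * n)%N by lia.
  by apply: leq_trans (leq_mul k1 (leq_mul k1 k2)) _; lia.
have nn : (n <= n * n)%N by nia.
have nnn : (n * n <= n * (n * n))%N by nia.
have kn' : (k * n <= n * n)%N by nia.
lia.
Qed.

(** Rounding [a] up to an integer and both logarithms up only enlarges [2 ^ m], which therefore
    dominates [L * a]. *)
Lemma hash_width_error (R : realType) (a : R) (L : nat) : 0 < a ->
  L%:R / 2 ^+ hash_width `|Num.ceil a|%N L <= 1 / a.
Proof.
move=> a0; set c := `|Num.ceil a|%N.
have ac : a <= c%:R.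
  rewrite /c natr_absz ger0_norm ?ceil_ge //.
  by rewrite ceil_ge0; apply: lt_trans a0; rewrite oppr_lt0.
have pw : (L * c <= 2 ^ hash_width c L)%N.
  rewrite /hash_width expnS expnD; apply: leq_trans (leq_pmull _ _) => //.
  by rewrite mulnC; apply: leq_mul; exact: up_logP.
rewrite ler_pdivrMr ?exprn_gt0 // mulrAC mul1r ler_pdivlMr //.
apply: (@le_trans _ _ (L * c)%:R); first by rewrite natrM; apply: ler_wpM2l.
by rewrite -natrX ler_nat.
Qed.

Theorem mainTheorem3 (R : realType) (alpha rate : R) (lengths : set nat)
    (C : forall n, {set 'rV['F_2]_n})
    (k : nat -> nat) (G : forall n, 'M['F_2]_(k n, n))
    (L : nat -> nat) (D : prog) (Tcode : nat -> nat)
    (halpha : 0 <= alpha)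
    (hrate : little_o lengths
       (fun n => log2 (#|C n|%:R : R) - rate * n%:R) (fun n => n%:R))
    (hlist : forall n, lengths n -> list_decodable alpha (L n) (C n))
    (hlinear : forall n, lengths n -> linear_code (C n))
    (hG : forall n, lengths n -> generator_matrix (G n) (C n))
    (hL : exists d : nat,
       big_O lengths (fun n => (L n)%:R : R) (fun n => n%:R ^+ d))
    (hD : forall n, lengths n ->
       list_decodes_within alpha (C n)
         (code_state (Num.truncn (alpha * n%:R)) (L n) (G n)) D (Tcode n))
    (hTcode : exists d : nat,
       big_O lengths (fun n => (Tcode n)%:R : R) (fun n => n%:R ^+ d))
    (a : nat -> R)
    (ha0 : forall n, lengths n -> 0 < a n)
    (haOmega : big_Omega lengths a (fun=> 1))
    (ha : exists g : nat -> R,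
       little_o lengths g (fun n => n%:R) /\
       forall n, lengths n -> a n = 2 `^ g n) :
  exists (P : forall n, protocol n) (A B : prog) (t1 t2 t3 : nat -> R),
    [/\ little_o lengths
          (fun n => (communication alpha (P n))%:R - (1 - rate) * n%:R)
          (fun n => n%:R),
        (forall n, lengths n -> forall x y : 'rV['F_2]_n,
           admissible alpha x y -> error_probability R (P n) x y <= 1 / a n),
        (forall n, lengths n ->
           implemented_within alpha (P n)
             (code_state (Num.truncn (alpha * n%:R)) (L n) (G n))
             `|Num.ceil (a n)|%N A B
             ((Tcode n)%:R + t1 n + t2 n + t3 n))
      & [/\ big_O lengths t1
              (fun n => a n * n%:R * (L n)%:R ^+ 2
                        * log2 (a n * n%:R * (L n)%:R ^+ 2)),
            big_O lengths t2 (fun n => (L n)%:R * n%:R ^+ 2)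
          & big_O lengths t3 (fun n => n%:R ^+ 3)]].
Proof.
case: ha => g [og ag].
(* The lists promised by the decoder are turned into a function by choice; placing [lengths n] under
   the existential makes that function total. *)
have decex n (y : 'rV['F_2]_n) : exists l, lengths n -> exists t v,
    [/\ exec D (decoder_input (code_state (Num.truncn (alpha * n%:R)) (L n) (G n)) y) t v,
      outputs_list v l, uniq l, l =i neighbours alpha (C n) y & (t <= Tcode n)%N].
  have [Nn|Nn] := pselect (lengths n); last by exists [::].
  by have [t [v [l H]]] := hD n Nn y; exists l => _; exists t, v.
pose dec n y := proj1_sig (cid (decex n y)).
have decP n y : lengths n -> exists t v,
    [/\ exec D (decoder_input (code_state (Num.truncn (alpha * n%:R)) (L n) (G n)) y) t v,
      outputs_list v (dec n y), uniq (dec n y), dec n y =i neighbours alpha (C n) y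
      & (t <= Tcode n)%N].
  by rewrite /dec; case: cid.
pose acc n := `|Num.ceil (a n)|%N; pose m n := hash_width (acc n) (L n).
pose q n := block_count n (m n).
have m0 n : (0 < m n)%N by [].
have decu n : lengths n -> forall y, uniq (dec n y).
  by move=> Nn y; have [t [v []]] := decP n y Nn.
have decE n : lengths n -> forall y, dec n y =i neighbours alpha (C n) y.
  by move=> Nn y; have [t [v []]] := decP n y Nn.
have kn n : lengths n -> (k n <= n)%N by move=> Nn; have [Gf _] := hG n Nn; exact: generator_dim Gf.
have osmall : little_o lengths (fun n => (m n)%:R : R) (fun n => n%:R).
  exact: hash_width_small hL ha0 og ag.
have oq e : 0 < e -> exists N0, forall n, (N0 <= n)%N -> lengths n ->
    [/\ (m n)%:R <= e * n%:R :> R & (q n * m n)%:R <= 2 * e * n%:R :> R].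
  (* The bound by [e] controls [m] itself and the bound by [e ^+ 2] feeds [block_length_small];
     together they give [q * m <= e * n + m <= 2 * e * n]. *)
  move=> e0; pose d := Num.min e (e ^+ 2).
  have d0 : 0 < d by rewrite lt_min e0 exprn_gt0.
  have [N0 H] := (little_oP _ _ _).1 osmall _ d0; exists N0 => n Nn0 Nn.
  have := H n Nn0 Nn; rewrite !ger0_norm // => mn.
  have me : (m n)%:R <= e * n%:R :> R.
    by apply: le_trans mn _; apply: ler_wpM2r => //; rewrite ge_min lexx.
  have me2 : (m n)%:R <= e ^+ 2 * n%:R :> R.
    by apply: le_trans mn _; apply: ler_wpM2r => //; rewrite ge_min lexx orbT.
  have := block_length_small (ltW e0) (m0 n) me2; rewrite -/(q n); split=> //; lra.
exists (fun n => sync_protocol (G n) (q n) (m n) (dec n)), alice, (bob D).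
(* The second term pays for testing the candidates, the third for everything else outside the
   decoder. *)
exists (fun=> 0), (fun n => (L n * (try_time n (q n) (m n) + 8))%:R),
  (fun n => (alice_time (k n) n (m n) (q n) + bob_time (k n) n (m n) (q n))%:R).
split.
- apply/little_oP => e e0.
  (* The rate contributes one seventh, the [m] additional seed bits one, and the two pieces of
     length [q * m] two each: six sevenths in total. *)
  have e7 : 0 < e / 7 by rewrite divr_gt0.
  have [N1 H1] := oq _ e7.
  have [N2 H2] := (little_oP _ _ _).1 hrate _ e7.
  exists (maxn N1 N2) => n; rewrite geq_max => /andP[n1 n2] Nn.
  have [h1 h2] := H1 n n1 Nn; have h3 := H2 n n2 Nn.
  have logC : log2 (#|C n|%:R : R) = (k n)%:R.
    rewrite (card_generated (hG n Nn)) natrX /log2 lnXn // mulrnAl divff //.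
    by rewrite gt_eqF // ln_gt0 // ltr1n.
  rewrite logC [`|n%:R|]ger0_norm // in h3.
  rewrite (communication_sync _ _ _ (hG n Nn)) // [`|n%:R|]ger0_norm //.
  rewrite !natrD natrB ?kn //.
  move: h3; rewrite !ler_norml => /andP[h3 h4]; apply/andP.
  have p0 : 0 <= (q n * m n)%:R :> R by [].
  have p1 : 0 <= (m n)%:R :> R by [].
  have p2 : 0 <= n%:R :> R by [].
  have p3 : 0 <= e * n%:R by rewrite mulr_ge0 // ltW.
  split; lra.
- move=> n Nn x y xy.
  apply: le_trans (hash_width_error (L n) (ha0 n Nn)).
  apply: (error_bound (hG n Nn) (hlist n Nn) (decu n Nn) (decE n Nn)) => //.
  exact: block_countP.
- move=> n Nn x y rA rB xy; have [Gf _] := hG n Nn.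
  have srA : size rA = (q n * m n + m n)%N by rewrite size_tuple.
  have [tA [sA [eA oA lA]]] := @alice_runs (k n) n (G n) (Num.truncn (alpha * n%:R)) (L n)
    (acc n) x rA Gf srA.
  have hdec y' : exists t v, [/\ exec D (decoder_input
        (code_state (Num.truncn (alpha * n%:R)) (L n) (G n)) y') t v,
      outputs_list v (dec n y'), (t <= Tcode n)%N & (size (dec n y') <= L n)%N].
    have [t [v [h1 h2 h3 h4 h5]]] := decP n y' Nn; exists t, v; split=> //.
    exact: (size_dec (hlist n Nn) (decu n Nn) (decE n Nn)).
  have rB0 : (rB : seq bool) = [::] by apply: size0nil; rewrite size_tuple.
  have [tB [sB [eB oB lB]]] := @bob_runs (k n) n (G n) (Num.truncn (alpha * n%:R)) (L n)
    (acc n) D (dec n) (Tcode n) y rB (message (G n) (q n) (m n) x rA) Gf rB0 hdec.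
  exists tA, sA, tB, sB; split=> //.
  rewrite addr0 -!natrD ler_nat; rewrite -/(m n) -/(q n) in lA lB; lia.
- split.
  + by apply/big_OP; exists 0, 0%N => n _ _; rewrite normr0 mul0r.
  + apply/big_OP; have [N1 H1] := oq 1 ltr01.
    (* Taking [e = 1] yields [m <= n] and [q * m <= 2 * n]; the successor of [N1] forces [n] to be
       positive. *)
    exists 400, N1.+1 => n n1 Nn; have [h1 h2] := H1 n (ltnW n1) Nn.
    rewrite mul1r ler_nat in h1; rewrite mulr1 -natrM ler_nat in h2.
    rewrite !ger0_norm ?mulr_ge0 ?exprn_ge0 //.
    rewrite -natrX -!natrM ler_nat mulnCA leq_mul2l; apply/orP; right.
    by apply: try_time_bound => //; [lia | exact: block_count_le].
  + apply/big_OP; have [N1 H1] := oq 1 ltr01.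
    exists 4000, N1.+1 => n n1 Nn; have [h1 h2] := H1 n (ltnW n1) Nn.
    rewrite mul1r ler_nat in h1; rewrite mulr1 -natrM ler_nat in h2.
    rewrite !ger0_norm ?exprn_ge0 // -natrX -natrM ler_nat.
    by apply: main_time_bound => //; [lia | exact: kn | exact: block_count_le].
Qed.
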